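(* Let $m,r,d$ be integers such that $m\ge 2$, $d\ge 1$ and $2\le 2r\le m-1$. Put $\beta=\lfloor rd/(m-2r)\rfloor$ and let $t = rd \bmod (m-2r)$ be the remainder of $rd$ modulo $m-2r$ (so $0\le t<m-2r$). Then there exists an $m\times m$ complex skew-symmetric matrix polynomial $W\in \mathrm{POL}^{ss}_{d,m\times m}$ of degree exactly $d$ and rank exactly $2r$, with no elementary divisors at all (neither finite nor infinite), with $t$ left minimal indices equal to $\beta+1$ and $m-2r-t$ left minimal indices equal to $\beta$, and with the right minimal indices equal to the left minimal indices, such that the set of $m\times m$ complex skew-symmetric matrix polynomials of grade $d$ with rank at most $2r$ is a closed subset of $\mathrm{POL}^{ss}_{d,m\times m}$ equal to $\overline{\mathrm{O}}(W)$.
   Context: $\mathrm{POL}^{ss}_{d,m\times m}$ is the vector space of $m\times m$ complex skew-symmetric matrix polynomials of grade $d$, i.e. $P(\lambda)=\sum_{i=0}^d\lambda^iA_i$ with $A_i\in\mathbb C^{m\times m}$, $A_i^T=-A_i$ ($A_d=0$ is allowed); the degree of $P$ is the largest $k$ with $A_k\neq 0$. It carries the topology of the distance $d(P,P')=\big(\sum_{i=0}^d\|A_i-A_i'\|_F^2\big)^{1/2}$. The rank of $P$ is the largest size of a minor that is not identically zero (the rank over $\mathbb C(\lambda)$). Elementary divisors. A skew-symmetric $P$ of rank $2\rho$ satisfies $F(\lambda)^TP(\lambda)F(\lambda)=\begin{bmatrix}0&g_1\\-g_1&0\end{bmatrix}\oplus\cdots\oplus\begin{bmatrix}0&g_\rho\\-g_\rho&0\end{bmatrix}\oplus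 0_{m-2\rho}$ for some unimodular matrix polynomial $F$ (constant nonzero determinant) and unique monic polynomials $g_j$ with $g_j\mid g_{j+1}$. For $\alpha\in\mathbb C$ write $g_j=(\lambda-\alpha)^{\sigma_j}p_j$, $p_j(\alpha)\ne0$; the sequence $\sigma_1=\sigma_1\le\sigma_2=\sigma_2\le\dots\le\sigma_\rho=\sigma_\rho$ (each repeated twice) is the sequence of partial multiplicities of $P$ at $\alpha$, and the factors $(\lambda-\alpha)^{\sigma_j}$ with $\sigma_j>0$ (each taken twice) are the elementary divisors at $\alpha$; $\alpha$ is a finite eigenvalue if some $\sigma_j>0$. The partial multiplicities and elementary divisors of $P\in\mathrm{POL}^{ss}_{d,m\times m}$ at $\infty$ are those of $\operatorname{rev}_dP(\lambda):=\lambda^dP(1/\lambda)$ at $0$ (they depend on the grade $d$); $\infty$ is an eigenvalue if $0$ is an eigenvalue of $\operatorname{rev}_d P$. Minimal indices. For a subspace $\mathcal V$ of $\mathbb C(\lambda)^m$, a minimal basis is a basis of vector polynomials whose sum of degrees is minimal among all such bases; the ordered list of degrees is independent of the minimal basis, and these are the minimal indices of $\mathcal V$. The left (right) minimal indices of $P$ are those of $\{y^T: y^TP=0\}$ (of $\{x: Px=0\}$) over $\mathbb C(\lambda)$. The complete eigenstructure of $P\in\mathrm{POL}^{ss}_{d,m\times m}$ consists of all its finite and infinite eigenvalues, the corresponding elementary divisors, and its left and right minimal indices. The orbit $\mathrm{O}(P)\subseteq\mathrm{POL}^{ss}_{d,m\times m}$ is the set of all polynomials in $\mathrm{POL}^{ss}_{d,m\times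 m}$ with the same complete eigenstructure as $P$, and $\overline{\mathrm{O}}(P)$ is its closure in $\mathrm{POL}^{ss}_{d,m\times m}$. *)

(* Defs.v *)
From HB Require Import structures.
From mathcomp Require Import all_boot all_order all_algebra.
From mathcomp Require Import boolp classical_sets reals topology.
From mathcomp Require Import complex.

Set Implicit Arguments.
Unset Strict Implicit.
Unset Printing Implicit Defensive.

Import Order.TTheory GRing.Theory Num.Theory.
Local Open Scope classical_set_scope.
Local Open Scope ring_scope.

Section SkewSymmetricMatrixPolynomials.
Variables (R : realType) (m d : nat).

Definition skew_of_grade (P : 'M[{poly R[i]}]_m) : bool :=
  (P^T == - P) && [forall i, forall j, (size (P i j) <= d.+1)%N].

Record POLss := MkPOLss {
  polmx :> 'M[{poly R[i]}]_m ;
  polmx_skew_of_grade : skew_of_grade polmx }.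

HB.instance Definition _ := [isSub for polmx].
HB.instance Definition _ := [Choice of POLss by <:].

End SkewSymmetricMatrixPolynomials.

Section Minkowski.
Variable R : realType.
Implicit Type I : finType.

Lemma sumr_sqr_ge0 I (f : I -> R) : 0 <= \sum_i f i ^+ 2.
Proof. by apply: sumr_ge0 => i _; apply: sqr_ge0. Qed.

Lemma sumr_sqr_eq0 I (f : I -> R) :
  Num.sqrt (\sum_i f i ^+ 2) = 0 -> forall i, f i = 0.
Proof.
move=> /eqP; rewrite sqrtr_eq0 le_eqVlt ltNge sumr_sqr_ge0 orbF.
rewrite psumr_eq0 => [/allP h0 i|i _]; last exact: sqr_ge0.
by apply/eqP; rewrite -sqrf_eq0; apply: h0; rewrite mem_index_enum.
Qed.

Lemma cauchy_schwarz_sum I (f g : I -> R) :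
  \sum_i f i * g i <= Num.sqrt (\sum_i f i ^+ 2) * Num.sqrt (\sum_i g i ^+ 2).
Proof.
set a := Num.sqrt _; set b := Num.sqrt _.
have a2 : \sum_i f i ^+ 2 = a ^+ 2 by rewrite sqr_sqrtr ?sumr_sqr_ge0.
have b2 : \sum_i g i ^+ 2 = b ^+ 2 by rewrite sqr_sqrtr ?sumr_sqr_ge0.
have [a0|a0] := eqVneq a 0.
  by rewrite big1 ?a0 ?mul0r // => i _; rewrite (sumr_sqr_eq0 a0) mul0r.
have [b0|b0] := eqVneq b 0.
  by rewrite big1 ?b0 ?mulr0 // => i _; rewrite (sumr_sqr_eq0 b0) mulr0.
have ab : 0 < a * b by rewrite mulr_gt0 // lt_def ?a0 ?b0 sqrtr_ge0.
have : 0 <= \sum_i (b * f i - a * g i) ^+ 2 by exact: sumr_sqr_ge0.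
have -> : \sum_i (b * f i - a * g i) ^+ 2 =
          a * b * (a * b - \sum_i f i * g i) *+ 2.
  transitivity (\sum_i (b ^+ 2 * f i ^+ 2 + a ^+ 2 * g i ^+ 2
                        - a * b * (f i * g i) *+ 2)).
    apply: eq_bigr => i _; rewrite sqrrB !exprMn addrAC; congr (_ + _ - _ *+ 2).
    by rewrite mulrACA [b * a]mulrC.
  rewrite sumrB big_split /= sumrMnl -!mulr_sumr a2 b2.
  by rewrite mulrBr mulrnBl mulr2n -expr2 exprMn [b ^+ 2 * _]mulrC.
by rewrite pmulrn_lge0 // pmulr_rge0 // subr_ge0.
Qed.

Lemma minkowski_sum I (f g h : I -> R) :
  (forall i, 0 <= h i <= f i + g i) ->
  Num.sqrt (\sum_i h i ^+ 2) <=
    Num.sqrt (\sum_i f i ^+ 2) + Num.sqrt (\sum_i g i ^+ 2).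
Proof.
move=> hfg; rewrite -(@ler_pXn2r _ 2) ?nnegrE ?addr_ge0 ?sqrtr_ge0 //.
rewrite sqrrD !sqr_sqrtr ?sumr_sqr_ge0 //.
apply: (@le_trans _ _ (\sum_i (f i + g i) ^+ 2)).
  apply: ler_sum => i _; have /andP[h0 hi] := hfg i.
  by rewrite ler_pXn2r ?nnegrE // (le_trans h0).
under eq_bigr do rewrite sqrrD.
by rewrite 2!big_split /= lerD2r lerD2l sumrMnl lerMn2r cauchy_schwarz_sum.
Qed.

End Minkowski.

Section Distance.
Variables (R : realType) (m : nat).

Definition coefmx (k : nat) (P : 'M[{poly R[i]}]_m) : 'M[R[i]]_m :=
  \matrix_(i, j) (P i j)`_k.

Definition frobenius (A : 'M[R[i]]_m) : R :=
  Num.sqrt (\sum_i \sum_j Normc.normc (A i j) ^+ 2).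

Lemma frobenius_ge0 A : 0 <= frobenius A. Proof. exact: sqrtr_ge0. Qed.

Lemma frobeniusN A : frobenius (- A) = frobenius A.
Proof.
congr Num.sqrt; apply: eq_bigr => i _; apply: eq_bigr => j _.
by rewrite mxE normcN.
Qed.

Lemma frobenius_eq0 A : frobenius A = 0 -> A = 0.
Proof.
rewrite /frobenius pair_bigA /= => /sumr_sqr_eq0 A0.
by apply/matrixP => i j; rewrite mxE; apply: Normc.eq0_normc (A0 (i, j)).
Qed.

Lemma frobenius_triangle A B : frobenius (A + B) <= frobenius A + frobenius B.
Proof.
rewrite /frobenius !pair_bigA /=; apply: minkowski_sum => -[i j] /=.
by rewrite mxE le_normcD; case: (A i j + B i j) => x y; rewrite sqrtr_ge0.
Qed.

Variable d : nat.
Implicit Types P Q : POLss R m d.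

Definition poldist P Q : R :=
  Num.sqrt (\sum_(k < d.+1) frobenius (coefmx k P - coefmx k Q) ^+ 2).

Lemma poldistxx P : poldist P P = 0.
Proof.
rewrite /poldist big1 ?sqrtr0 // => k _; rewrite subrr /frobenius big1 ?sqrtr0.
  by rewrite expr0n.
by move=> i _; rewrite big1 // => j _; rewrite mxE Normc.normc0 expr0n.
Qed.

Lemma poldist_positivity P Q : poldist P Q = 0 -> P = Q.
Proof.
move=> /sumr_sqr_eq0 PQ0; apply/val_inj/matrixP => i j; apply/polyP => k.
have [kd|kd] := ltnP k d.+1.
  have /frobenius_eq0/eqP := PQ0 (Ordinal kd); rewrite subr_eq0 => /eqP/matrixP.
  by move=> /(_ i j); rewrite !mxE.
have szle (S : POLss R m d) : (size (S i j) <= k)%N.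
  case: S => S /= /andP[_ /forallP/(_ i)/forallP/(_ j) h].
  exact: leq_trans h kd.
by rewrite !nth_default ?szle.
Qed.

Lemma poldist_sym P Q : poldist P Q = poldist Q P.
Proof.
congr Num.sqrt; apply: eq_bigr => k _.
by rewrite -frobeniusN opprB.
Qed.

Lemma poldist_triangle Q P S : poldist P S <= poldist P Q + poldist Q S.
Proof.
apply: minkowski_sum => k; rewrite frobenius_ge0 /=.
by apply: le_trans (frobenius_triangle _ _); rewrite addrA subrK.
Qed.

HB.instance Definition _ := @isMetric.Build R (POLss R m d)
  poldist poldistxx poldist_positivity poldist_sym poldist_triangle.

End Distance.

Section CompleteEigenstructure.
Variable R : realType.
Local Notation C := R[i].
Local Notation K := {fraction {poly C}}.

Definition fracmx (n m : nat) (P : 'M[{poly C}]_(n, m)) : 'M[K]_(n, m) :=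
  map_mx (@tofrac _) P.

Definition polrank (m : nat) (P : 'M[{poly C}]_m) : nat := \rank (fracmx P).

Definition has_degree (m : nat) (P : 'M[{poly C}]_m) (k : nat) : Prop :=
  coefmx k P != 0 /\ forall l, (k < l)%N -> coefmx l P = 0.

Definition unimodular (m : nat) (F : 'M[{poly C}]_m) : bool :=
  size (\det F) == 1%N.

(* The direct sum of the blocks [0, g_j; - g_j, 0] for j < size g, padded by
   zeros; g is indexed from 0, so the j-th block has rows 2j and 2j+1.  *)
Definition skew_blocks (m : nat) (g : seq {poly C}) : 'M[{poly C}]_m :=
  \matrix_(i, j)
    if ~~ odd i && (j == i.+1 :> nat) then g`_(i./2)
    else if ~~ odd j && (i == j.+1 :> nat) then - g`_(j./2)
    else 0.

Definition skew_smith_form (m : nat) (P : 'M[{poly C}]_m)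
    (g : seq {poly C}) : Prop :=
  [/\ polrank P = (size g).*2,
      all (fun p => p \is monic) g,
      sorted (fun p q => p %| q) g &
      exists2 F, unimodular F & F^T *m P *m F = skew_blocks m g].

(* A skew-symmetric P has exactly one skew Smith form, so that for such P the
   default value [::] of xget is irrelevant.  *)
Definition invariant_polys (m : nat) (P : 'M[{poly C}]_m) : seq {poly C} :=
  xget [::] [set g | skew_smith_form P g].

Definition partial_mults (m : nat) (P : 'M[{poly C}]_m) (a : C) : seq nat :=
  flatten [seq [:: mup a g; mup a g] | g <- invariant_polys P].

Definition elementary_divisors (m : nat) (P : 'M[{poly C}]_m) (a : C) :
    seq {poly C} :=
  [seq ('X - a%:P) ^+ s | s <- partial_mults P a & (0 < s)%N].

Definition eigenvalue_of (m : nat) (P : 'M[{poly C}]_m) (a : C) : bool :=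
  has (fun s => (0 < s)%N) (partial_mults P a).

Definition rev_pol (d m : nat) (P : 'M[{poly C}]_m) : 'M[{poly C}]_m :=
  \matrix_(i, j) \poly_(k < d.+1) (P i j)`_(d - k).

Definition elementary_divisors_infty (m d : nat) (P : POLss R m d) :
    seq {poly C} :=
  elementary_divisors (rev_pol d P) 0.

Definition eigenvalue_infty (m d : nat) (P : POLss R m d) : bool :=
  eigenvalue_of (rev_pol d P) 0.

Definition row_degree (m : nat) (v : 'rV[{poly C}]_m) : nat :=
  \max_j (size (v ord0 j)).-1.

(* A subspace of K^m is given as the row space of a matrix V, and a family of
   \rank V polynomial vectors as the rows of a matrix B.  *)
Definition polynomial_basis (n m : nat) (V : 'M[K]_(n, m))
    (B : 'M[{poly C}]_(\rank V, m)) : Prop :=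
  row_free (fracmx B) /\ (fracmx B == V)%MS.

Definition minimal_basis (n m : nat) (V : 'M[K]_(n, m))
    (B : 'M[{poly C}]_(\rank V, m)) : Prop :=
  polynomial_basis B /\
  forall B' : 'M[{poly C}]_(\rank V, m), polynomial_basis B' ->
    (\sum_i row_degree (row i B) <= \sum_i row_degree (row i B'))%N.

(* Minimal bases exist and all of them have the same degrees, so that the
   default value [::] of xget is irrelevant.  *)
Definition minimal_indices (n m : nat) (V : 'M[K]_(n, m)) : seq nat :=
  xget [::] [set s | exists2 B : 'M[{poly C}]_(\rank V, m),
    minimal_basis B & s = sort leq [seq row_degree (row i B) | i : 'I__]].

Definition left_minimal_indices (m : nat) (P : 'M[{poly C}]_m) : seq nat :=
  minimal_indices (kermx (fracmx P)).

(* P x = 0 is x^T P^T = 0.  *)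
Definition right_minimal_indices (m : nat) (P : 'M[{poly C}]_m) : seq nat :=
  minimal_indices (kermx (fracmx P)^T).

Definition same_eigenstructure (m d : nat) (P Q : POLss R m d) : Prop :=
  (forall a, eigenvalue_of P a = eigenvalue_of Q a) /\
  (forall a, elementary_divisors P a = elementary_divisors Q a) /\
  eigenvalue_infty P = eigenvalue_infty Q /\
  elementary_divisors_infty P = elementary_divisors_infty Q /\
  left_minimal_indices P = left_minimal_indices Q /\
  right_minimal_indices P = right_minimal_indices Q.

Definition polss_orbit (m d : nat) (P : POLss R m d) : set (POLss R m d) :=
  [set Q | same_eigenstructure P Q].

End CompleteEigenstructure.

(* Main.v *)
Require Import Defs.
From mathcomp Require Import all_boot all_order all_algebra.
From mathcomp Require Import boolp classical_sets reals topology.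
From mathcomp Require Import complex.
From mathcomp Require Import ring zify lra.

(** Let u ^ v denote the skew-symmetric matrix u^T v - v^T u of two row
    vectors, and J the standard symplectic matrix.  A sum of r wedges of
    polynomial vectors is the same thing as a product A J A^T, where the 2r
    columns of the polynomial matrix A are the vectors.  The theorem follows
    from three facts on such factorizations.

    Density.  A skew-symmetric P of grade d and rank at most 2r is a sum of r
    wedges u_j ^ v_j with deg u_j + deg v_j <= d.  Indeed, a pair of polynomial
    vectors x, y for which x P y^T is nonzero of least degree splits off a
    wedge and lowers the rank by two (skew_peel), and a symplectic form of row
    reduction lowers the degrees as long as the leading terms of the wedges
    cancel (lower_total_size).  A wedge of degrees (k, d - k) with k < d./2 is
    a limit of wedges of degrees (k + 1, d - k - 1) (wedge_balance_step).
    Hence the products A J A^T whose columns have degrees d./2 and d - d./2, r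
    of each, are dense among the P of rank at most 2r (balanced_approx).

    Genericity.  Put n = m - 2r, beta = rd %/ n and t = rd %% n, and consider
    the linear maps z |-> z A from vectors of bounded degree.  The conditions
    that this map be onto for deg z <= beta, and one-to-one for deg z < beta,
    say that certain minors of its matrix do not vanish.  On a line through two
    matrices A, if they hold at one point then they hold at all but finitely
    many (conv_rank_line); a sparse zigzag matrix satisfies them
    (zigzag_realization).  So they hold arbitrarily close to every A.

    Eigenstructure.  These conditions determine the complete eigenstructure of
    A J A^T (generic_eigenstructure).  Surjectivity gives A a polynomial left
    inverse, and its matrix of leading coefficients a constant one: the rank is
    2r at every finite point and at infinity, and there are no elementary
    divisors.  The null vectors of A J A^T are those of A.  None but 0 has
    degree less than beta, those of degree at most beta form a space of
    dimension n - t by rank-nullity, and those of degree at most beta + 1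
    generate all of them (kernel_generated); so the minimal indices are n - t
    times beta and t times beta + 1 (minimal_indices_kernel).

    The product built from the zigzag matrix is therefore the required W, and
    its orbit is dense among the polynomials of rank at most 2r.  These form a
    closed set because the rank is lower semicontinuous
    (rank_lower_semicontinuous), and they contain the orbit because the number
    of left minimal indices is m minus the rank. *)

Set Implicit Arguments.
Unset Strict Implicit.
Unset Printing Implicit Defensive.

Import Order.TTheory GRing.Theory Num.Theory.
Local Open Scope ring_scope.

Local Notation frac := (map_mx (@tofrac _)).
Local Notation ev a := (map_mx (horner_eval a)).
Local Notation nc := (@Normc.normc _).

(** * Fraction fields and rank *)

Section Fractions.
Variable D : idomainType.
Local Open Scope quotient_scope.

Lemma tofrac_numden (x : {fraction D}) :
  exists2 d : D, d != 0 & exists n : D, tofrac d * x = tofrac n.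
Proof.
elim/quotW: x => r; exists r.2; first exact: denom_ratioP.
exists r.1; unlock tofrac; rewrite -[LHS]FracField.pi_mul.
apply/eqmodP; rewrite /= /FracField.equivf /FracField.mulf.
by rewrite !numden_Ratio ?mul1r ?oner_neq0 ?denom_ratioP // mulr1 mulrC.
Qed.

Lemma clear_denominators a b (X : 'M[{fraction D}]_(a, b)) :
  exists2 q : D, q != 0 & exists Y : 'M[D]_(a, b), tofrac q *: X = frac Y.
Proof.
have /boolp.choice [d dP] : forall ij : 'I_a * 'I_b, exists d : D, d != 0 /\
    exists n, tofrac d * X ij.1 ij.2 = tofrac n.
  by move=> ij; have [d d0 dn] := tofrac_numden (X ij.1 ij.2); exists d.
have dn ij := (dP ij).2; have /boolp.choice [n nP] := dn.
exists (\prod_ij d ij); first by apply/prodf_neq0 => ij _; exact: (dP ij).1.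
exists (\matrix_(i, j) ((\prod_(ij | ij != (i, j)) d ij) * n (i, j))).
apply/matrixP => i j; rewrite !mxE (bigD1 (i, j)) //= !tofracM -nP /=.
by rewrite -mulrA mulrCA.
Qed.

End Fractions.

Section RankPeel.
Variable K : fieldType.

(** The rows of X P are independent modulo those of Q, because
    multiplication by X^T kills the latter and is injective on the former. *)
Lemma mxrank_peel m k (P Q : 'M[K]_m) (X : 'M_(k, m)) :
  (Q <= P)%MS -> Q *m X^T = 0 -> row_free (X *m P *m X^T) ->
  (\rank Q + k <= \rank P)%N.
Proof.
move=> QP QX XPX.
have XPf : row_free (X *m P).
  by apply/row_freeP; have /row_freeP[B] := XPX; rewrite -mulmxA => XB;
     exists (X^T *m B); rewrite mulmxA -mulmxA XB.
rewrite -(eqP XPf) -mxrank_disjoint_sum.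
  by apply: mxrankS; rewrite addsmx_sub QP submxMl.
apply/eqP/rowV0P => w; rewrite sub_capmx => /andP[/submxP[y ->] /submxP[z yz]].
have : z *m (X *m P *m X^T) = 0.
  by rewrite !mulmxA -[z *m _ *m _]mulmxA -yz -mulmxA QX mulmx0.
by move/(canRL (mulmxKp XPX)); rewrite mul0mx yz => ->; rewrite mul0mx.
Qed.
End RankPeel.

(** * Skew-symmetric polynomial matrices as sums of wedges *)

Section Wedge.
Variables (T : comNzRingType) (m : nat).
Implicit Types u v : 'rV[T]_m.

Definition wedge u v : 'M[T]_m := u^T *m v - v^T *m u.

Lemma wedgeE u v a b : wedge u v a b = u 0 a * v 0 b - v 0 a * u 0 b.
Proof. by rewrite !mxE !big_ord1 !mxE. Qed.

Lemma wedge0 v : wedge 0 v = 0.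
Proof. by apply/matrixP => a b; rewrite wedgeE !mxE; ring. Qed.

Lemma wedger0 v : wedge v 0 = 0.
Proof. by apply/matrixP => a b; rewrite wedgeE !mxE; ring. Qed.

Lemma wedgeN u v : wedge v (- u) = wedge u v.
Proof. by apply/matrixP => a b; rewrite !wedgeE !mxE; ring. Qed.

Lemma wedge_sum_l (I : finType) (u : I -> 'rV[T]_m) v :
  wedge (\sum_i u i) v = \sum_i wedge (u i) v.
Proof.
apply/matrixP => a b; rewrite wedgeE summxE !summxE mulr_suml mulr_sumr -sumrB.
by apply: eq_bigr => i _; rewrite wedgeE.
Qed.

(** A symplectic change of the family of vectors: u_k becomes a combination
    of all of them, and multiples of v_k added to the partners of the vectors
    used compensate for it. *)
Lemma wedge_transvection r (u v : 'I_r -> 'rV[T]_m) (f g : 'I_r -> T) k :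
  f k = 1 ->
  \sum_j wedge (if j == k then \sum_i (f i *: u i + g i *: v i)
                else u j + g j *: v k)
               (if j == k then v k else v j - f j *: v k) =
  \sum_j wedge (u j) (v j).
Proof.
move=> fk; rewrite (bigD1 k) //= eqxx wedge_sum_l (bigD1 k) //= -addrA.
rewrite -big_split /= [RHS](bigD1 k) //=; congr (_ + _).
  by apply/matrixP => a b; rewrite !wedgeE !mxE fk; ring.
apply: eq_bigr => j /negbTE ->.
by apply/matrixP => a b; rewrite !(wedgeE, mxE); ring.
Qed.

End Wedge.

Section SkewDecomposition.
Variables (F : numFieldType) (m : nat).
Implicit Types (P : 'M[{poly F}]_m) (x y z : 'rV[{poly F}]_m).

Local Notation form P x y := ((x *m P *m y^T) 0 0).

Lemma skew_form P x y : P^T = - P -> form P y x = - form P x y.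
Proof.
move=> Ps; rewrite -[LHS](mxE trmx_key (fun i j => (y *m P *m x^T) j i)).
rewrite -/(trmx _) !trmx_mul trmxK Ps mulmxA mulmxN mulNmx.
by rewrite [LHS]mxE.
Qed.

Lemma skew_form_diag P x : P^T = - P -> form P x x = 0.
Proof.
move=> Ps; apply/eqP; have := skew_form x x Ps => /eqP.
by rewrite -subr_eq0 opprK -mulr2n -mulr_natl mulf_eq0 -polyC_natr polyC_eq0
  pnatr_eq0.
Qed.

Lemma form_delta P x b : form P x (delta_mx (0 : 'I_1) b) = (x *m P) 0 b.
Proof. by rewrite trmx_delta -colE mxE. Qed.

Lemma form_lin P x y z (q : {poly F}) :
  form P x (z - q *: y) = form P x z - q * form P x y.
Proof. by rewrite linearB linearZ /= mulmxBr -scalemxAr !mxE. Qed.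

(** Subtracting from z a multiple of y replaces x P z^T by its remainder
    modulo p = x P y^T, and the minimality of the degree of p leaves only the
    remainder zero. *)
Lemma minimal_form_dvd P x y : form P x y != 0 ->
  (forall z, form P x z != 0 -> (size (form P x y) <= size (form P x z))%N) ->
  forall z, form P x y %| form P x z.
Proof.
move=> p0 pmin z; have := pmin (z - (form P x z %/ form P x y) *: y).
rewrite form_lin {1 3}(divp_eq (form P x z) (form P x y)) addrAC subrr add0r.
rewrite /dvdp; case: eqP => // r0 /(_ isT).
by rewrite leqNgt ltn_modp p0.
Qed.

(** For x, y such that p = x P y^T is nonzero of least degree, p divides x P
    and y P; with x P = p xi and y P = p eta, the matrix P - (p xi) ^ eta is
    polynomial and is killed by x and y, on which P is nondegenerate. *)
Lemma skew_peel P : P^T = - P -> P != 0 ->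
  exists u v, let Q := P - wedge u v in
    Q^T = - Q /\ (\rank (frac Q) + 2 <= \rank (frac P))%N.
Proof.
move=> Ps P0.
pose N := fun n => `[< exists x y, form P x y != 0 /\ size (form P x y) = n >].
have exN : exists n, N n.
  have [a [b Pab]] : exists a b, P a b != 0.
    apply: contrapT => H; case/eqP: P0; apply/matrixP => a b; rewrite mxE.
    by apply/eqP; apply: contrapT => /negP h; apply: H; exists a, b.
  exists (size (P a b)); apply/asboolP.
  by exists (delta_mx 0 a), (delta_mx 0 b); rewrite form_delta -rowE mxE.
case: (ex_minnP exN) => n /asboolP[x [y [p0 <-]]] nmin {exN}.
have pmin x' y' : form P x' y' != 0 ->
  (size (form P x y) <= size (form P x' y'))%N.
  by move=> h; apply: nmin; apply/asboolP; exists x', y'.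
set p := form P x y in p0 pmin.
have dx z : p %| form P x z by apply: minimal_form_dvd => // z'; exact: pmin.
have pN : form P y x = - p by exact: skew_form.
have dy z : p %| form P y z.
  rewrite -dvdpNl -pN; apply: minimal_form_dvd => [|z' h].
    by rewrite pN oppr_eq0.
  by rewrite pN size_polyN; exact: pmin.
pose xi := \row_b ((x *m P) 0 b %/ p).
pose eta := \row_b ((y *m P) 0 b %/ p).
have xiE : p *: xi = x *m P.
  by apply/rowP => b; rewrite mxE [X in _ * X]mxE mulrC divpK -?form_delta.
have etE : p *: eta = y *m P.
  by apply/rowP => b; rewrite mxE [X in _ * X]mxE mulrC divpK -?form_delta.
exists (p *: xi), eta => Q.
have QE : Q = P - wedge (p *: xi) eta by [].
(* Over the fraction field, the rows of Q are combinations of those of P. *)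
have pQE : p *: Q = (p *: 1%:M - P *m (y^T *m x - x^T *m y)) *m P.
  rewrite QE scalerBr mulmxBl -scalemxAl mul1mx; congr (_ - _).
  transitivity (wedge (p *: xi) (p *: eta)).
    by apply/matrixP => a b; rewrite !(wedgeE, mxE); ring.
  rewrite /wedge xiE etE !trmx_mul Ps mulmxBr mulmxBl !mulNmx opprK.
  by rewrite !mulmxA addrC.
have Qs : Q^T = - Q.
  rewrite QE linearB /= Ps opprD; congr (_ - _).
  by apply/matrixP => a b; rewrite !(wedgeE, mxE); ring.
split=> //.
pose X := col_mx x y.
(* The products of x and y with xi and eta are known only after multiplication
   by p, which is regular. *)
have Qx0 (w : 'rV_m) (e1 e2 : {poly F}) : (w *m xi^T) 0 0 = e1 ->
  (w *m eta^T) 0 0 = e2 -> w *m P = e1 *: (p*:eta) - (e2 * p) *: xi ->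
  w *m Q = 0.
  move=> h1 h2 h3; rewrite QE /wedge !mulmxBr !mulmxA h3.
  have -> : w *m (p *: xi)^T = (p * e1)%:M.
    by rewrite linearZ /= -scalemxAr [_ *m _]mx11_scalar h1 scale_scalar_mx.
  rewrite [w *m eta^T]mx11_scalar h2 !mul_scalar_mx !scalerA.
  by rewrite [p * e1]mulrC subrr.
have pinv (c c' : {poly F}) : p * c = p * c' -> c = c' by exact: mulfI.
have dotE (w e z : 'rV_m) : p *: e = z *m P -> p * (w *m e^T) 0 0 = form P z w.
  move=> h; transitivity ((w *m (p *: e)^T) 0 0).
    by rewrite linearZ /= -scalemxAr [RHS]mxE.
  rewrite h trmx_mul Ps mulNmx mulmxN mulmxA.
  by rewrite [LHS]mxE (skew_form z w Ps) opprK.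
have xX : x *m Q = 0.
  apply: (Qx0 _ 0 (- 1)).
  - by apply: pinv; rewrite (dotE _ _ _ xiE) mulr0 skew_form_diag.
  - by apply: pinv; rewrite (dotE _ _ _ etE) pN; ring.
  - by rewrite -xiE scale0r sub0r mulN1r scaleNr opprK.
have yX : y *m Q = 0.
  apply: (Qx0 _ 1 0).
  - by apply: pinv; rewrite (dotE _ _ _ xiE); rewrite mulr1.
  - by apply: pinv; rewrite (dotE _ _ _ etE) mulr0 skew_form_diag.
  - by rewrite -etE scale1r mul0r scale0r subr0.
apply: (@mxrank_peel _ _ _ _ _ (frac X)).
- have p1 : tofrac p != 0 by rewrite tofrac_eq0.
  rewrite -(eqmx_scale _ p1) -map_mxZ pQE map_mxM; exact: submxMl.
- rewrite map_trmx -map_mxM; have -> : Q *m X^T = 0; last by rewrite map_mx0.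
  apply: trmx_inj; rewrite trmx_mul trmxK Qs trmx0 mulmxN mul_col_mx xX yX.
  by rewrite col_mx0 oppr0.
- rewrite map_trmx -!map_mxM.
  have -> : X *m P *m X^T = block_mx 0 p%:M (- p%:M) 0.
    rewrite mul_col_mx tr_col_mx mul_col_row; congr block_mx;
      rewrite [LHS]mx11_scalar.
    + by rewrite skew_form_diag // raddf0.
    + by [].
    + by rewrite pN raddfN.
    + by rewrite skew_form_diag // raddf0.
  apply/row_freeP; exists (map_mx (fun c => (tofrac p)^-1 * tofrac c) (block_mx
    0 (- 1) 1%:M 0)).
  have p1 : tofrac p != 0 by rewrite tofrac_eq0.
  transitivity ((tofrac p)^-1 *: frac (block_mx 0 p%:M (- p%:M) 0 *m block_mx 0
    (- 1) 1%:M 0 : 'M_(1+1))).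
    rewrite map_mxM scalemxAr; congr (_ *m _).
    by apply/matrixP => i j; rewrite [LHS]mxE [RHS]mxE; congr (_ * _);
      rewrite [RHS]mxE.
  rewrite mulmx_block !mul0mx !mulmx0 !addr0 !add0r mulmx1 mulmxN mulNmx opprK
    mulmx1.
  rewrite -scalar_mx_block map_scalar_mx scale_scalar_mx mulVf //.
Qed.

Lemma skew_sum_wedge r P : P^T = - P -> (\rank (frac P) <= 2 * r)%N ->
  exists u v : 'I_r -> 'rV[{poly F}]_m, P = \sum_j wedge (u j) (v j).
Proof.
elim: r P => [|r IH] P Ps.
  rewrite muln0 leqn0 mxrank_eq0 => /eqP P0.
  exists (fun=> 0), (fun=> 0); rewrite big_ord0; apply/matrixP => a b.
  by have /matrixP/(_ a b) := P0; rewrite !mxE => /eqP;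
    rewrite tofrac_eq0 => /eqP.
have [->|P0] := eqVneq P 0.
  move=> _; exists (fun=> 0), (fun=> 0); rewrite big1 // => j _; exact: wedge0.
have [u [v [Qs Qr]]] := skew_peel Ps P0.
rewrite mulnS => Pr; have := leq_trans Qr Pr; rewrite addnC leq_add2l.
move=> /(IH _ Qs)[u' [v' E]].
exists (fun j => if unlift ord0 j is Some i then u' i else u).
exists (fun j => if unlift ord0 j is Some i then v' i else v).
rewrite big_ord_recl unlift_none; under eq_bigr do rewrite liftK.
by rewrite -E addrC subrK.
Qed.

End SkewDecomposition.

(** * Degree reduction of sums of wedges *)

Section SizeOfVectors.
Variable T : nzRingType.

(** One more than the degree, so that 0 is the value at the zero vector
    only. *)
Definition rsize m (u : 'rV[{poly T}]_m) : nat := \max_b size (u 0%R b).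

Lemma rsizeP m (u : 'rV[{poly T}]_m) k :
  reflect (forall b, (size (u 0%R b) <= k)%N) (rsize u <= k)%N.
Proof.
apply: (iffP idP) => [h b|h]; last by apply/bigmax_leqP => b _; exact: h.
exact: leq_trans (leq_bigmax b) h.
Qed.

Lemma size_le_rsize m (u : 'rV[{poly T}]_m) b : (size (u 0%R b) <= rsize u)%N.
Proof. exact: (rsizeP _ _ (leqnn _)). Qed.

Lemma rsize0 m : rsize (0 : 'rV[{poly T}]_m) = 0%N.
Proof. by rewrite /rsize big1 // => b _; rewrite mxE size_poly0. Qed.

Lemma rsizeN m (u : 'rV[{poly T}]_m) : rsize (- u) = rsize u.
Proof. by apply: eq_bigr => b _; rewrite mxE size_polyN. Qed.

Lemma rsize_eq0 m (u : 'rV[{poly T}]_m) : rsize u = 0%N -> u = 0.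
Proof.
move=> u0; apply/rowP => b; rewrite mxE; apply/eqP; rewrite -size_poly_leq0.
by apply: leq_trans (size_le_rsize _ _) _; rewrite u0.
Qed.

Lemma rsize_attained m (u : 'rV[{poly T}]_m) :
  (0 < rsize u)%N -> exists b, (u 0 b)`_(rsize u).-1 != 0.
Proof.
move=> u0; apply: contrapT => H; move: u0; rewrite ltnNge => /negP; apply.
have {}H b : (u 0 b)`_(rsize u).-1 = 0.
  by apply/eqP; apply: contrapT => /negP h; apply: H; exists b.
have : (rsize u <= (rsize u).-1)%N; last by case: rsize => // n; rewrite ltnn.
apply/rsizeP => b; apply/leq_sizeP => j; rewrite leq_eqVlt => /orP[/eqP <- //|].
by move=> hj; apply: nth_default; apply: leq_trans (size_le_rsize u b) _; lia.
Qed.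
End SizeOfVectors.

Lemma shift_leq x y k : (x <= y -> y <= k -> k - y + x <= k)%N.
Proof. lia. Qed.

Lemma shift_leq_compl x a b a' b' D :
  (x <= b -> a + b = D -> a' + b' = D -> b' <= a -> a - b' + x <= a')%N.
Proof. lia. Qed.

Section DegreeReduction.
Variables (F : fieldType) (m r : nat).
Implicit Types (u v : 'I_r -> 'rV[{poly F}]_m).

Lemma size_monomialM (a : F) n (p : {poly F}) :
  (size ((a *: 'X^n) * p)%R <= n + size p)%N.
Proof.
rewrite -scalerAl; apply: leq_trans (size_scale_leq _ _) _.
by apply: leq_trans (size_polyMleq _ _) _; rewrite size_polyXn addSn.
Qed.

Definition total_size u v := (\sum_j (rsize (u j) + rsize (v j)))%N.

Lemma coef_monomialM (a : F) (p : {poly F}) s k : (size p <= s)%N ->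
  (s <= k)%N ->
  ((a *: 'X^(k - s)) * p)`_k.-1 = a * p`_s.-1.
Proof.
move=> ps sk; rewrite -scalerAl coefZ coefXnM; congr (_ * _).
case: (posnP s) => [s0|s0].
  have -> : p = 0 by apply/eqP; rewrite -size_poly_leq0 -s0.
  by rewrite !coef0 if_same.
by case: ltnP => [|_]; [lia|congr (_`_ _); lia].
Qed.

(** The relation between leading vectors, completed by monomials that align
    the degrees, is a combination in which the leading vector of u_k cancels.
    The compensating multiples of v_k do not raise any degree, because all the
    vectors in the relation belong to pairs with the same degree sum D as the
    pair k. *)
Lemma lower_total_size_at u v D k (c c' : 'I_r -> F) :
  c k != 0 -> (0 < rsize (u k))%N -> (rsize (u k) + rsize (v k) = D)%N ->
  (forall j, c j != 0 ->
     (rsize (u j) + rsize (v j) = D /\ rsize (u j) <= rsize (u k))%N) ->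
  (forall j, c' j != 0 ->
     (rsize (u j) + rsize (v j) = D /\ rsize (v j) <= rsize (u k))%N) ->
  (forall a, \sum_j (c j * (u j 0 a)`_(rsize (u j)).-1
                     + c' j * (v j 0 a)`_(rsize (v j)).-1) = 0) ->
  exists u' v', \sum_j wedge (u' j) (v' j) = \sum_j wedge (u j) (v j) /\
    (total_size u' v' < total_size u v)%N.
Proof.
set s := fun j => rsize (u j); set t := fun j => rsize (v j).
move=> ck0 sk0 Dk cP c'P rel.
pose f j := (c j / c k) *: 'X^(s k - s j).
pose g j := (c' j / c k) *: 'X^(s k - t j).
have fk : f k = 1 by rewrite /f divff // subnn scale1r expr0.
have fz j : c j = 0 -> f j = 0 by rewrite /f => ->; rewrite mul0r scale0r.
have gz j : c' j = 0 -> g j = 0 by rewrite /g => ->; rewrite mul0r scale0r.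
exists (fun j => if j == k then \sum_i (f i *: u i + g i *: v i)
                 else u j + g j *: v k).
exists (fun j => if j == k then v k else v j - f j *: v k).
split; first exact: wedge_transvection.
rewrite /total_size (bigD1 k) //= [in ltnRHS](bigD1 k) //= eqxx -addSn.
apply: leq_add.
  rewrite -addSn leq_add2r -/(s k) -[s k]prednK // ltnS.
  apply/rsizeP => a; rewrite summxE; apply/leq_sizeP => l.
  have szf i : (size ((f i *: u i) 0%R a) <= s k)%N.
    rewrite mxE; have [/fz ->|/cP[_ h]] := eqVneq (c i) 0;
      first by rewrite mul0r size_poly0.
    apply: leq_trans (size_monomialM _ _ _) _.
    exact: shift_leq (size_le_rsize (u i) a) h.
  have szg i : (size ((g i *: v i) 0%R a) <= s k)%N.
    rewrite mxE; have [/gz ->|/c'P[_ h]] := eqVneq (c' i) 0;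
      first by rewrite mul0r size_poly0.
    apply: leq_trans (size_monomialM _ _ _) _.
    exact: shift_leq (size_le_rsize (v i) a) h.
  rewrite leq_eqVlt coef_sum => /orP[/eqP <-|hl]; last first.
    rewrite big1 // => i _; rewrite mxE coefD !nth_default ?addr0 //.
      by apply: leq_trans (szg i) _; lia.
    by apply: leq_trans (szf i) _; lia.
  transitivity ((c k)^-1 * 0); last by rewrite mulr0.
  rewrite -[in RHS](rel a) mulr_sumr; apply: eq_bigr => i _.
  rewrite mxE coefD mulrDr; congr (_ + _); rewrite mxE.
    have [c0|/cP[_ h]] := eqVneq (c i) 0;
      first by rewrite fz // c0 !mul0r coef0 mulr0.
    by rewrite coef_monomialM ?size_le_rsize // mulrA [_^-1 * _]mulrC.
  have [c0|/c'P[_ h]] := eqVneq (c' i) 0;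
    first by rewrite gz // c0 !mul0r coef0 mulr0.
  by rewrite coef_monomialM ?size_le_rsize // mulrA [_^-1 * _]mulrC.
apply: leq_sum => j /negbTE ->; apply: leq_add; apply/rsizeP => a; rewrite !mxE.
  apply: leq_trans (size_polyD _ _) _; rewrite geq_max size_le_rsize /=.
  have [/gz ->|/c'P[Dj h]] := eqVneq (c' j) 0;
    first by rewrite mul0r size_poly0.
  apply: leq_trans (size_monomialM _ _ _) _.
  exact: (shift_leq_compl (size_le_rsize (v k) a) Dk _ h).
apply: leq_trans (size_polyD _ _) _;
  rewrite geq_max size_le_rsize size_polyN /=.
have [/fz ->|/cP[Dj h]] := eqVneq (c j) 0; first by rewrite mul0r size_poly0.
apply: leq_trans (size_monomialM _ _ _) _.
by apply: (shift_leq_compl (size_le_rsize (v k) a) Dk _ h); rewrite addnC.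
Qed.

Lemma coefM_top (p q : {poly F}) s t : (size p <= s)%N -> (size q <= t)%N ->
  (0 < s)%N -> (0 < t)%N -> (p * q)`_(s + t - 2) = p`_s.-1 * q`_t.-1.
Proof.
case: s t => // s [//|t] ps qt _ _; rewrite coefM /=.
have lt : (s < (s.+1 + t.+1 - 2).+1)%N by lia.
rewrite (bigD1 (Ordinal lt)) //= big1 ?addr0.
  by congr (_ * _`_ _); lia.
move=> i /eqP ni; have [h|h] := ltnP s i.
  by rewrite nth_default ?mul0r // (leq_trans ps).
have {}h : (i < s)%N.
  by rewrite ltn_neqAle h andbT; apply/eqP => E; apply: ni; apply: val_inj.
by rewrite [q`__]nth_default ?mulr0 // (leq_trans qt) //; lia.
Qed.

Lemma coefM_over (p q : {poly F}) s t k : (size p <= s)%N -> (size q <= t)%N ->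
  (s + t < k.+2)%N -> (p * q)`_k = 0.
Proof.
move=> ps qt h; apply: nth_default; apply: leq_trans (size_polyMleq _ _) _; lia.
Qed.

(** Let D be the largest value of s_j + t_j, where s_j and t_j are the sizes
    of u_j and v_j.  If D > d + 2 then the coefficient of degree D - 2 of the
    sum vanishes; it is the sum of the wedges lu_j ^ lv_j of the leading vectors
    of the pairs that reach D.  Any column of this matrix identity is a linear
    relation between leading vectors, whose coefficients are entries of them;
    it is applied to the longest vector that occurs in it. *)
Lemma lower_total_size d u v :
  (forall a b, (size ((\sum_j wedge (u j) (v j))%R a b) <= d.+1)%N) ->
  (exists j, (d.+2 < rsize (u j) + rsize (v j))%N) ->
  exists u' v', \sum_j wedge (u' j) (v' j) = \sum_j wedge (u j) (v j) /\
    (total_size u' v' < total_size u v)%N.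
Proof.
move=> Pd [j1 hj1].
pose s j := rsize (u j); pose t j := rsize (v j).
have [j0 _ j0max] := arg_maxnP (fun j => s j + t j)%N (erefl (xpredT j1)).
set D := (s j0 + t j0)%N in j0max.
have Dd : (d.+2 < D)%N by apply: leq_trans hj1 _; exact: j0max.
have [st0|st0] := eqVneq (s j0 * t j0)%N 0%N.
  exists (fun j => if j == j0 then 0 else u j).
  exists (fun j => if j == j0 then 0 else v j).
  split.
    apply: eq_bigr => j _; case: eqP => [->|//]; rewrite wedge0.
    move/eqP: st0; rewrite muln_eq0 => /orP[]/eqP/rsize_eq0 ->;
      first by rewrite wedge0.
    by rewrite wedger0.
  rewrite /total_size (bigD1 j0) //= [in ltnRHS](bigD1 j0) //= eqxx !rsize0
    -addSn.
  apply: leq_add; first by rewrite -/(s j0) -/(t j0) -/D; lia.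
  by apply: leq_sum => j /negbTE ->.
pose top j := (s j + t j == D)%N.
pose lu j a := if top j then (u j 0 a)`_(s j).-1 else 0.
pose lv j a := if top j then (v j 0 a)`_(t j).-1 else 0.
have coefD2 j a b :
    (wedge (u j) (v j) a b)`_(D - 2) = lu j a * lv j b - lv j a * lu j b.
  rewrite wedgeE coefB /lu /lv /top; case: eqP => [E|/eqP E]; last first.
    have lt : (s j + t j < D)%N by rewrite ltn_neqAle E; exact: j0max.
    have over (x y : {poly F}) :
        (size x <= s j)%N -> (size y <= t j)%N -> (x * y)`_(D - 2) = 0.
      move=> xs yt; apply: coefM_over xs yt _; apply: leq_trans lt _.
      by clear -Dd; lia.
    by rewrite [v j 0 a * _]mulrC !over ?size_le_rsize // !mul0r.
  have [s0|s0] := posnP (s j).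
    have u0 : u j = 0 by exact: rsize_eq0.
    by rewrite u0 !mxE !(mul0r, mulr0, coef0).
  have [t0|t0] := posnP (t j).
    have u0 : v j = 0 by exact: rsize_eq0.
    by rewrite u0 !mxE !(mul0r, mulr0, coef0).
  by rewrite -E {1}coefM_top ?size_le_rsize // addnC coefM_top ?size_le_rsize.
have rel a b : \sum_j (lu j a * lv j b - lv j a * lu j b) = 0.
  transitivity (((\sum_j wedge (u j) (v j)) a b)`_(D - 2)).
    by rewrite summxE coef_sum; apply: eq_bigr => j _; rewrite coefD2.
  by apply: nth_default; apply: leq_trans (Pd a b) _; lia.
have s0 : (0 < s j0)%N by move: st0; rewrite muln_eq0; lia.
have t0 : (0 < t j0)%N by move: st0; rewrite muln_eq0; lia.
(* The entry b of lu_j0 makes the relation given by column b nontrivial. *)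
have [b lub] := rsize_attained s0.
have top0 : top j0 by rewrite /top.
(* The boolean tells the vectors v_j (true) from the vectors u_j (false). *)
pose cf (x : 'I_r * bool) := if x.2 then lu x.1 b else lv x.1 b.
pose w (x : 'I_r * bool) := if x.2 then t x.1 else s x.1.
have cfP0 : cf (j0, true) != 0 by rewrite /cf /= /lu top0.
have [[k e] /= cfk wmax] := @arg_maxnP _ (j0, true) (fun x => cf x != 0) w cfP0.
have luT j : lu j b != 0 -> (s j + t j = D)%N.
  by rewrite /lu; case: ifP => [/eqP|_] //; rewrite eqxx.
have lvT j : lv j b != 0 -> (s j + t j = D)%N.
  by rewrite /lv; case: ifP => [/eqP|_] //; rewrite eqxx.
have luF j a : lu j b * lv j a = lu j b * (v j 0 a)`_(t j).-1.
  have [->|/luT h] := eqVneq (lu j b) 0; first by rewrite !mul0r.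
  by rewrite /lv /top h eqxx.
have lvF j a : lv j b * lu j a = lv j b * (u j 0 a)`_(s j).-1.
  have [->|/lvT h] := eqVneq (lv j b) 0; first by rewrite !mul0r.
  by rewrite /lu /top h eqxx.
case: e cfk wmax => /= cfk wmax.
  have [||||| u' [v' [E lt]]] := @lower_total_size_at v (fun j => - u j) D k
    (fun j => lu j b) (fun j => lv j b) cfk.
  - exact: leq_trans t0 (wmax (j0, true) cfP0).
  - by rewrite rsizeN addnC; exact: luT.
  - move=> j jb; rewrite rsizeN; split; first by rewrite addnC; exact: luT.
    exact: (wmax (j, true)).
  - move=> j jb; rewrite rsizeN; split; first by rewrite addnC; exact: lvT.
    exact: (wmax (j, false)).
  - move=> a; rewrite -[RHS]oppr0 -[in RHS](rel a b) -sumrN.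
    apply: eq_bigr => j _.
    by rewrite rsizeN mxE coefN mulrN -luF -lvF; ring.
  exists u', v'; split; last by rewrite (leq_trans lt) //;
    apply: leq_sum => j _; rewrite rsizeN addnC.
  by rewrite E; apply: eq_bigr => j _; rewrite wedgeN.
have [||||| u' [v' [E lt]]] := @lower_total_size_at u v D k
  (fun j => lv j b) (fun j => - lu j b) cfk.
- exact: leq_trans t0 (wmax (j0, true) cfP0).
- exact: lvT.
- by move=> j jb; split; [exact: lvT|exact: (wmax (j, false))].
- move=> j; rewrite oppr_eq0 => jb; split; [exact: luT|exact: (wmax (j, true))].
- move=> a; rewrite -[RHS](rel a b); apply: eq_bigr => j _.
  by rewrite mulNr -luF -lvF; ring.
by exists u', v'.
Qed.

(** Once no pair exceeds d + 2, a pair of nonzero vectors has degree sum at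
    most d; a pair with a zero vector contributes nothing and is replaced by
    zero, since its other vector may have a larger degree. *)
Lemma wedge_sum_graded d u v :
  (forall a b, (size ((\sum_j wedge (u j) (v j))%R a b) <= d.+1)%N) ->
  exists u' v', \sum_j wedge (u' j) (v' j) = \sum_j wedge (u j) (v j) /\
    forall j, exists2 k, (k <= d)%N &
      (rsize (u' j) <= k.+1)%N /\ (rsize (v' j) <= (d - k).+1)%N.
Proof.
have [n] := ubnP (total_size u v); elim: n u v => // n IH u v /ltnSE le Pd.
have [[j hj]|H] := pselect (exists j, d.+2 < rsize (u j) + rsize (v j))%N.
  have [u' [v' [E lt]]] := lower_total_size Pd (ex_intro _ j hj).
  have [||u2 [v2 [E2 h]]] := IH u' v'; first exact: leq_trans lt le.
    by rewrite E.
  by exists u2, v2; rewrite E2 E.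
pose z j := (rsize (u j) == 0)%N || (rsize (v j) == 0)%N.
exists (fun j => if z j then 0 else u j), (fun j => if z j then 0 else v j);
  split.
  apply: eq_bigr => j _; rewrite /z.
  have [/rsize_eq0 ->|_] := eqVneq (rsize (u j)) 0%N; first by rewrite !wedge0.
  have [/rsize_eq0 ->|//] := eqVneq (rsize (v j)) 0%N.
  by rewrite wedge0 wedger0.
move=> j; case: ifP => [_|]; first by exists 0%N; rewrite ?rsize0.
move=> /negbT; rewrite negb_or => /andP[uj vj];
  have : ~ (d.+2 < rsize (u j) + rsize (v j))%N.
  by move=> h; apply: H; exists j.
by exists (rsize (u j)).-1; lia.
Qed.
End DegreeReduction.

(** * Rank along a line of matrices *)

Section GenericRank.
Variable F : fieldType.

Lemma mxrank_inverses p q (A : 'M[F]_(p, q)) :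
  exists X : 'M_(\rank A, p), exists Y : 'M_(q, \rank A), X *m A *m Y = 1%:M.
Proof.
have /row_fullP[X XA] := col_base_full A.
have /row_freeP[Y AY] := row_base_free A.
exists X, Y; have E := mulmx_base A; rewrite -AY; congr (_ *m _).
by rewrite -[RHS]mul1mx -XA -mulmxA E.
Qed.

Lemma mxrank_det k p q (A : 'M[F]_(p, q)) (X : 'M_(k, p)) (Y : 'M_(q, k)) :
  \det (X *m A *m Y) != 0 -> (k <= \rank A)%N.
Proof.
move=> d0; have /mxrank_unit <- : X *m A *m Y \in unitmx by rewrite unitmxE
  unitfE.
by apply: leq_trans (mxrankM_maxl _ _) _; exact: mxrankM_maxr.
Qed.

(** Take X and Y with X (A + B) Y = 1, of size the rank of A + B.  The
    determinant of X (A + s B) Y is a polynomial in s and is 1 at s = 1. *)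
Lemma mxrank_line p q (A B : 'M[F]_(p, q)) :
  exists2 f : {poly F}, f != 0 &
    forall s, f.[s] != 0 -> (\rank (A + B)%R <= \rank (A + s *: B)%R)%N.
Proof.
have [X [Y XY]] := mxrank_inverses (A + B).
pose f := \det (map_mx polyC X *m (map_mx polyC A + 'X *: map_mx polyC B)
                *m map_mx polyC Y).
have fE s : f.[s] = \det (X *m (A + s *: B) *m Y).
  rewrite -[LHS]/(horner_eval s f) -det_map_mx !map_mxM map_mxD map_mxZ.
  have mapC a b (M : 'M[F]_(a, b)) : ev s (map_mx polyC M) = M.
    by apply/matrixP => i j; rewrite !mxE /= /horner_eval hornerC.
  by rewrite !mapC /= /horner_eval hornerX.
exists f => [|s]; last by rewrite fE; exact: mxrank_det.
apply/eqP => f0; have := fE 1; rewrite f0 horner0 scale1r XY det1.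
by move/eqP; rewrite eq_sym oner_eq0.
Qed.
End GenericRank.

(** * Multiplication by a polynomial matrix in bounded degree *)

Lemma size_sum_leq (T : nzRingType) (I : finType) (f : I -> {poly T}) k :
  (forall i, (size (f i) <= k)%N) -> (size (\sum_i f i)%R <= k)%N.
Proof.
by move=> fk; apply: leq_trans (size_sum _ _ _) _; apply/bigmax_leqP => i _.
Qed.

Section Convolution.
Variables (F : fieldType) (m N : nat) (e : 'I_N -> nat).
Implicit Types (A : 'M[{poly F}]_(m, N)) (z : 'rV[{poly F}]_m).

Definition col_degrees A := forall i j, (size (A i j) <= (e j).+1)%N.

(** For A of full column rank at all points of the projective line,
    conv_onto k A and conv_inj k A say that the twist by k - 1 of the kernel
    bundle of A has no H^1, respectively no H^0. *)
Definition conv_onto k A := forall h : 'rV[{poly F}]_N,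
  (forall j, (size (h 0%R j) <= k + e j)%N) ->
  exists2 z, (rsize z <= k)%N & z *m A = h.

Definition conv_inj k A := forall z, (rsize z <= k)%N -> z *m A = 0 -> z = 0.

Definition source k : finType := ('I_m * 'I_k)%type.
Definition target k : finType := {j : 'I_N & 'I_(k + e j)}.

Definition source_val k : 'I_#|source k| -> 'I_m * 'I_k := fun x => enum_val x.
Lemma source_valK k (x : 'I_#|source k|) : enum_rank (source_val x) = x.
Proof. exact: enum_valK. Qed.

Definition target_val k : 'I_#|target k| -> {j : 'I_N & 'I_(k + e j)} :=
  fun y => enum_val y.

(** The matrix of z |-> z A in the bases of monomials. *)
Definition conv k A : 'M[F]_(#|source k|, #|target k|) :=
  \matrix_(x, y) let: (i, l) := source_val x in
    ('X^l * A i (tag (target_val y)))`_(tagged (target_val y)).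

Definition poly_of k (c : 'rV[F]_#|source k|) : 'rV[{poly F}]_m :=
  \row_i \sum_(l < k) c 0 (enum_rank (i, l)) *: 'X^l.

Definition vec_of k z : 'rV[F]_#|source k| :=
  \row_x let: (i, l) := source_val x in (z 0 i)`_l.

Lemma card_source k : #|source k| = (m * k)%N.
Proof. by rewrite card_prod !card_ord. Qed.

Lemma card_target k : #|target k| = (\sum_j (k + e j))%N.
Proof.
rewrite card_tagged sumnE big_map big_enum /=.
by apply: eq_bigr => j _; rewrite card_ord.
Qed.

Lemma rsize_poly_of k (c : 'rV[F]_#|source k|) : (rsize (poly_of c) <= k)%N.
Proof.
apply/rsizeP => i; rewrite mxE; apply: size_sum_leq => l.
by apply: leq_trans (size_scale_leq _ _) _; rewrite size_polyXn.
Qed.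

Lemma poly_ofK k : cancel (@poly_of k) (@vec_of k).
Proof.
move=> c; apply/rowP => x; rewrite mxE -[x in RHS]source_valK.
case: (source_val x) => i l; rewrite mxE coef_sum (bigD1 l) //= coefZ coefXn
  eqxx mulr1.
rewrite big1 ?addr0 // => l' /negbTE ll'.
by rewrite coefZ coefXn eq_sym (inj_eq val_inj) ll' mulr0.
Qed.

Lemma vec_ofK k z : (rsize z <= k)%N -> poly_of (vec_of k z) = z.
Proof.
move=> /rsizeP zk; apply/rowP => i; rewrite mxE -[RHS](take_poly_id (zk i)).
apply/polyP => n; rewrite coef_sum coef_take_poly; case: ltnP => h.
  rewrite (bigD1 (Ordinal h)) //= coefZ coefXn eqxx mulr1 mxE /source_val
    enum_rankK.
  rewrite big1 ?addr0 // => l' ll'.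
  rewrite coefZ coefXn; case: eqP => [E|]; last by rewrite mulr0.
  by case/eqP: ll'; apply: val_inj.
rewrite big1 // => l _; rewrite coefZ coefXn; case: eqP => [E|];
  last by rewrite mulr0.
by have := ltn_ord l; rewrite -E ltnNge h.
Qed.

Lemma poly_of_sum k (I : finType) (a : I -> F) (c : I -> 'rV[F]_#|source k|) :
  poly_of (\sum_i a i *: c i) = \sum_i (a i)%:P *: poly_of (c i).
Proof.
apply/rowP => i; rewrite mxE summxE.
under eq_bigr do rewrite summxE scaler_suml.
rewrite exchange_big; apply: eq_bigr => x _ /=;
  rewrite mxE mul_polyC mxE scaler_sumr.
by apply: eq_bigr => l _; rewrite mxE scalerA.
Qed.

Lemma conv_coef k A (c : 'rV[F]_#|source k|) y :
  (c *m conv k A) 0 y =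
  ((poly_of c *m A) 0 (tag (target_val y)))`_(tagged (target_val y)).
Proof.
rewrite mxE mxE coef_sum.
under [RHS]eq_bigr do rewrite mxE mulr_suml coef_sum.
rewrite pair_bigA /= (reindex (@source_val k)) /=; last first.
  by apply: onW_bij; exact: enum_val_bij.
apply: eq_bigr => x _; rewrite mxE -[x in c 0 x]source_valK.
by case: (source_val x) => i l /=; rewrite -scalerAl coefZ.
Qed.

Lemma size_mul_col_degrees k A z j : col_degrees A -> (rsize z <= k)%N ->
  (size ((z *m A) 0%R j) <= k + e j)%N.
Proof.
move=> Ae /rsizeP zk; rewrite mxE; apply: size_sum_leq => i.
apply: leq_trans (size_polyMleq _ _) _.
by rewrite -subn1 leq_subLR add1n -addnS leq_add.
Qed.

Lemma poly_of_mul k A (c : 'rV[F]_#|source k|) (h : 'rV[{poly F}]_N) :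
  col_degrees A ->
  (forall j, (size (h 0%R j) <= k + e j)%N) ->
  (forall y, (c *m conv k A) 0 y =
             (h 0 (tag (target_val y)))`_(tagged (target_val y))) ->
  poly_of c *m A = h.
Proof.
move=> Ae hk E; apply/rowP => j; apply/polyP => q.
case: (ltnP q (k + e j)) => hq.
  pose jq : target k := Tagged (fun j => 'I_(k + e j)) (Ordinal hq).
  have := E (enum_rank jq).
  by rewrite conv_coef /target_val enum_rankK.
rewrite !nth_default ?(leq_trans (hk j)) //.
by apply: leq_trans hq; apply: size_mul_col_degrees => //; exact: rsize_poly_of.
Qed.

Lemma conv_ontoP k A : col_degrees A -> conv_onto k A <-> row_full (conv k A).
Proof.
move=> Ae; split=> [onto|/row_fullP[X XA] h hk].
  rewrite -sub1mx; apply/row_subP => y; apply/submxP.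
  pose jq := target_val y.
  have [|z zk zA] := onto (\row_j if j == tag jq then 'X^(tagged jq) else 0).
    move=> j; rewrite mxE; case: eqP => [->|_]; last by rewrite size_poly0.
    by rewrite size_polyXn.
  exists (vec_of k z); apply/rowP => y'; rewrite conv_coef vec_ofK // zA !mxE.
  have [<-|ny] := eqVneq y y'; first by rewrite eqxx coefXn eqxx.
  case: eqP => [E|_]; last by rewrite coef0.
  rewrite coefXn; case: eqP => // E2; case/eqP: ny; apply: enum_val_inj.
  move: E E2; rewrite -/(target_val y) -/(target_val y') /jq.
  by case: (target_val y) (target_val y') => [j q] [j' q'] /= E;
    subst j' => /val_inj ->.
pose hv : 'rV[F]_#|target k| :=
  \row_y (h 0 (tag (target_val y)))`_(tagged (target_val y)).
exists (poly_of (hv *m X)); first exact: rsize_poly_of.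
apply: poly_of_mul => // y; rewrite -mulmxA XA mulmx1 mxE //.
Qed.

Lemma conv_injP k A : col_degrees A -> conv_inj k A <-> row_free (conv k A).
Proof.
move=> Ae; split=> [inj|free z zk zA].
  rewrite -kermx_eq0; apply/rowV0P => c /sub_kermxP cA.
  rewrite -[c]poly_ofK (inj (poly_of c)) ?rsize_poly_of //.
    by apply/rowP => x; rewrite !mxE; case: (source_val x) => i l;
      rewrite mxE coef0.
  apply: poly_of_mul => // [j|y]; first by rewrite mxE size_poly0.
  by rewrite cA !mxE coef0.
rewrite -(vec_ofK zk); suff -> : vec_of k z = 0.
  by apply/rowP => i; rewrite !mxE big1 // => l _; rewrite mxE scale0r.
apply/eqP; rewrite -(mulmx_free_eq0 _ free); apply/eqP/rowP => y.
by rewrite conv_coef vec_ofK // zA !mxE coef0.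
Qed.

Lemma conv_line k A B (s : F) :
  conv k (A + s%:P *: B) = conv k A + s *: conv k B.
Proof.
apply/matrixP => x y; rewrite !mxE; case: (source_val x) => i l.
by rewrite !mxE mulrDr coefD mulrCA mul_polyC coefZ.
Qed.

Lemma col_degrees_line A A' (s : F) : col_degrees A -> col_degrees A' ->
  col_degrees (A + s%:P *: (A' - A)).
Proof.
move=> Ae Ae' i j; rewrite !mxE.
have [h h'] := (Ae i j, Ae' i j).
apply: leq_trans (size_polyD _ _) _; rewrite geq_max h mul_polyC.
apply: leq_trans (size_scale_leq _ _) _; apply: leq_trans (size_polyD _ _) _.
by rewrite size_polyN geq_max h h'.
Qed.

(** As conv k A depends affinely on A, to be onto or one-to-one is a generic
    condition on the line through A and A' once it holds at A'. *)
Lemma conv_rank_line k A A' : exists2 f : {poly F}, f != 0 &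
  forall s, f.[s] != 0 ->
    (\rank (conv k A') <= \rank (conv k (A + s%:P *: (A' - A))))%N.
Proof.
have [f f0 fP] := mxrank_line (conv k A) (conv k (A' - A)).
exists f => // s /fP; rewrite conv_line -[X in conv k A + X]scale1r -conv_line.
by rewrite polyC1 scale1r [A + _]addrC subrK.
Qed.

End Convolution.

(** * The null vectors of a polynomial matrix *)

Section Kernel.
Variables (F : fieldType) (m N : nat) (e : 'I_N -> nat).
Variable A : 'M[{poly F}]_(m, N).
Hypothesis Ae : col_degrees e A.

Lemma frac_eq0 p q (B : 'M[{poly F}]_(p, q)) : frac B = 0 -> B = 0.
Proof.
move=> /matrixP E; apply/matrixP => i j; have /eqP := E i j.
by rewrite [frac B i j]mxE [(0 : 'M_(_, _)) i j]mxE tofrac_eq0 [RHS]mxE => /eqP.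
Qed.

Lemma eq0_of_mulX (T : nzRingType) p q (B : 'M[{poly T}]_(p, q)) :
  'X *: B = 0 -> B = 0.
Proof.
move=> /matrixP E; apply/matrixP => i j; apply/polyP => l.
by have /polyP/(_ l.+1) := E i j; rewrite !mxE coefXM !coef0.
Qed.

Lemma constant_shift p (z : 'rV[{poly F}]_p) :
  z = map_mx (fun p : {poly F} => (p`_0)%:P) z + 'X *: map_mx (drop_poly 1) z
    :> 'rV[{poly F}]_p.
Proof.
apply/rowP => i; rewrite !mxE -{1}(poly_take_drop 1 (z 0 i)) expr1 mulrC.
by congr (_ + _); apply/polyP => -[|l]; rewrite coef_take_poly coefC.
Qed.

(** The argument of Castelnuovo and Mumford.  By surjectivity in degree < k,
    the constant term z_0 of a null vector z is also the constant term of a null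
    vector y = z_0 + X y' of degree at most k: the equation for y' is
    y' A = - z_0 A / X.  The difference z - y is then divisible by X. *)
Lemma kernel_step k z : conv_onto e k A -> z *m A = 0 -> exists y w,
  [/\ z = y + 'X *: w, y *m A = 0, w *m A = 0, (rsize y <= k.+1)%N &
      (rsize w <= maxn k (rsize z).-1)%N].
Proof.
move=> onto zA.
pose z0 := map_mx (fun p : {poly F} => (p`_0)%:P) z.
pose z1 := map_mx (drop_poly 1) z.
have zE : z = z0 + 'X *: z1 by exact: constant_shift.
have z0A j : ((z0 *m A) 0 j)`_0 = 0.
  have /rowP/(_ j) := zA; rewrite zE mulmxDl -scalemxAl !mxE => /polyP/(_ 0%N).
  by rewrite coefD coefXM addr0 coef0.
have [|y' y'k y'A] := onto (- map_mx (drop_poly 1) (z0 *m A)).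
  move=> j; rewrite !mxE size_polyN size_drop_poly leq_subLR.
  have z0k : (rsize z0 <= 1)%N.
    by apply/rsizeP => i; rewrite mxE size_polyC leq_b1.
  have := size_mul_col_degrees j Ae z0k; rewrite mxE => h.
  by apply: leq_trans h _; rewrite leq_add2l leq_addl.
pose y := z0 + 'X *: y'; pose w := z1 - y'.
have yA : y *m A = 0.
  rewrite /y mulmxDl -scalemxAl y'A scalerN.
  have {1}-> := constant_shift (z0 *m A); rewrite addrK.
  by apply/rowP => j; rewrite mxE z0A mxE.
have zyw : z = y + 'X *: w.
  by rewrite [LHS]zE /y /w scalerBr -addrA [X in _ = _ + X]addrC subrK.
exists y, w; split=> //.
- apply: eq0_of_mulX; rewrite scalemxAl.
  by move: zA; rewrite {1}zyw mulmxDl yA add0r.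
- apply/rsizeP => i; rewrite !mxE; apply: leq_trans (size_polyD _ _) _.
  rewrite geq_max (leq_trans (size_polyC_leq1 _)) //=.
  apply: leq_trans (size_polyMleq _ _) _; rewrite size_polyX /=.
  exact: rsizeP y'k i.
apply/rsizeP => i; rewrite !mxE; apply: leq_trans (size_polyD _ _) _.
rewrite size_polyN geq_max size_drop_poly subn1 !leq_max.
rewrite (rsizeP _ _ y'k i) orbC /=.
by have := size_le_rsize z i; case: (size _) (rsize z) => [|a] [|b] //=; lia.
Qed.

Lemma kernel_generated k p (V : 'M_(p, m)) : conv_onto e k A ->
  (forall z : 'rV_m, (rsize z <= k.+1)%N -> z *m A = 0 -> (frac z <= V)%MS) ->
  forall z : 'rV_m, z *m A = 0 -> (frac z <= V)%MS.
Proof.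
move=> onto Vk z; have [n] := ubnP (rsize z).
elim: n z => // n IH z /ltnSE zn zA.
have [|kz] := leqP (rsize z) k.+1; first by move/Vk; apply.
have [y [w [zE yA wA yk wk]]] := kernel_step onto zA.
rewrite zE map_mxD map_mxZ addmx_sub ?Vk // scalemx_sub // IH //.
by apply: leq_ltn_trans wk _; move: (rsize z) zn kz; clear => s; lia.
Qed.

(** A constant combination of the rows whose coefficient of degree k vanishes
    is a null vector of degree < k, hence zero.  So the coefficient vectors of
    degree k of the rows are independent, and no polynomial combination can
    cancel its leading term. *)
Lemma low_kernel_free k p (B : 'M[{poly F}]_(p, m)) : conv_inj k A ->
  (forall i, (rsize (row i B) <= k.+1)%N) -> B *m A = 0 ->
  (forall c : 'rV[F]_p, map_mx polyC c *m B = 0 -> c = 0) ->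
  row_free (frac B).
Proof.
move=> inj Bk BA Bfree; rewrite -kermx_eq0; apply/rowV0P => w /sub_kermxP wB.
have [q q0 [c cE]] := clear_denominators w.
have q1 : tofrac q != 0 by rewrite tofrac_eq0.
have cB : c *m B = 0.
  by apply: frac_eq0; rewrite map_mxM -cE -scalemxAl wB scaler0.
suff c0 : c = 0.
  by move/eqP: cE; rewrite c0 map_mx0 scaler_eq0 (negbTE q1) => /eqP.
apply: rsize_eq0; apply/eqP; rewrite -leqn0 leqNgt; apply/negP => s0.
have [b] := rsize_attained s0.
pose cl : 'rV[F]_p := map_mx (coefp (rsize c).-1) c.
suff /rowP/(_ b) : cl = 0 by rewrite !mxE /= => ->; rewrite eqxx.
apply: Bfree; apply: inj; last by rewrite -mulmxA BA mulmx0.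
apply/rsizeP => j; apply/leq_sizeP => l; rewrite leq_eqVlt => /orP[/eqP <-|kl].
  have cB0 : \sum_i (c 0 i * B i j)`_(rsize c + k.+1 - 2) = 0.
    by rewrite -coef_sum; have /rowP/(_ j) := cB; rewrite !mxE => ->;
      rewrite coef0.
  rewrite mxE coef_sum -[RHS]cB0; apply: eq_bigr => i _.
  have := rsizeP _ _ (Bk i) j; rewrite mxE => h.
  by rewrite (coefM_top (size_le_rsize c i) h) // mxE coefCM /= mxE.
rewrite mxE coef_sum big1 // => i _; rewrite mxE coefCM nth_default ?mulr0 //.
by have := rsizeP _ _ (Bk i) j; rewrite mxE => h; apply: leq_trans h kl.
Qed.

Lemma low_kernel_basis k :
  exists B : 'M[{poly F}]_(\rank (kermx (conv e k A)), m),
  [/\ forall i, (rsize (row i B) <= k)%N, B *m A = 0,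
      forall c : 'rV[F]_ _, map_mx polyC c *m B = 0 -> c = 0 &
      forall z, (rsize z <= k)%N -> z *m A = 0 ->
        exists c : 'rV[F]_ _, z = map_mx polyC c *m B].
Proof.
pose R := row_base (kermx (conv e k A)).
pose B := \matrix_i poly_of (row i R).
have BE c : map_mx polyC c *m B = poly_of (c *m R).
  rewrite !mulmx_sum_row poly_of_sum; apply: eq_bigr => i _.
  by rewrite mxE rowK.
exists B; split=> [i||c|z zk zA].
- by rewrite rowK rsize_poly_of.
- apply/row_matrixP => i; rewrite row_mul rowK row0.
  apply: (@poly_of_mul _ _ _ e) => // [j|y]; first by rewrite mxE size_poly0.
  have /sub_kermxP -> : (row i R <= kermx (conv e k A))%MS.
    by apply: submx_trans (row_sub _ _) _; rewrite eq_row_base.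
  by rewrite !mxE coef0.
- rewrite BE => E; have : c *m R = 0.
    rewrite -[LHS]poly_ofK E; apply/rowP => x; rewrite !mxE.
    by case: (source_val x) => i l; rewrite mxE coef0.
  by move/eqP; rewrite mulmx_free_eq0 ?row_base_free // => /eqP.
have /submxP[c cE] : (vec_of k z <= R)%MS.
  rewrite eq_row_base; apply/sub_kermxP/rowP => y.
  by rewrite conv_coef vec_ofK // zA !mxE coef0.
by exists c; rewrite BE -cE vec_ofK.
Qed.

(** Rows independent over the fraction field are independent over F, and the
    null vectors of degree < k have the dimension on the right. *)
Lemma card_low_rows k p (B : 'M[{poly F}]_(p, m)) :
  row_free (frac B) -> B *m A = 0 ->
  (#|[set i | (rsize (row i B) <= k)%N]| <= \rank (kermx (conv e k A)))%N.
Proof.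
set S := [set i | _] => Bfree BA.
have Sk (i : 'I_#|S|) : (rsize (row (enum_val i) B) <= k)%N.
  by have := enum_valP i; rewrite inE.
pose G := \matrix_(i < #|S|) vec_of k (row (enum_val i) B).
have GK : (G <= kermx (conv e k A))%MS.
  apply/sub_kermxP/row_matrixP => i; rewrite row_mul rowK row0.
  by apply/rowP => y; rewrite conv_coef vec_ofK // -row_mul BA !mxE coef0.
apply: leq_trans (mxrankS GK); suff /eqP -> : row_free G by [].
rewrite -kermx_eq0; apply/rowV0P => c /sub_kermxP cG.
pose c' : 'rV[{poly F}]_p := \sum_i (c 0 i)%:P *: delta_mx 0 (enum_val i).
have c'B : c' *m B = 0.
  rewrite /c' mulmx_suml.
  transitivity (poly_of (c *m G)); last first.
    by rewrite cG; apply/rowP => i; rewrite !mxE big1 // => l _;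
      rewrite mxE scale0r.
  rewrite mulmx_sum_row poly_of_sum; apply: eq_bigr => i _.
  by rewrite -scalemxAl -rowE rowK vec_ofK.
have c'0 : c' = 0.
  have /eqP : frac c' *m frac B = 0 by rewrite -map_mxM c'B map_mx0.
  by rewrite mulmx_free_eq0 // => /eqP/frac_eq0.
apply/rowP => i; have /rowP/(_ (enum_val i)) := c'0;
  rewrite summxE (bigD1 i) //=.
rewrite big1 => [|i' ii']; last first.
  by rewrite !mxE eqxx /= [_ == _]eq_sym (inj_eq enum_val_inj) (negbTE ii')
    mulr0.
by rewrite !mxE !eqxx mulr1 addr0 => /eqP; rewrite polyC_eq0 => /eqP.
Qed.

Lemma conv_onto_left_inverse k : conv_onto e k.+1 A ->
  exists X : 'M[{poly F}]_(N, m), X *m A = 1%:M.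
Proof.
move=> onto; have /boolp.choice[x xP] : forall j, exists z : 'rV_m, z *m A =
  delta_mx 0 j.
  move=> j; have [|z _ zA] := onto (delta_mx 0 j); last by exists z.
  move=> j'; rewrite mxE; apply: leq_trans (leq_addr _ _).
  by case: (_ && _); rewrite ?mulr1n ?mulr0n ?size_poly1 ?size_poly0.
exists (\matrix_j x j); apply/row_matrixP => j.
by rewrite row_mul rowK xP row1.
Qed.

Lemma rank_frac_onto k : conv_onto e k.+1 A -> \rank (frac A) = N.
Proof.
case/conv_onto_left_inverse => X XA; apply/eqP; apply/row_fullP.
by exists (frac X); rewrite -map_mxM XA map_mx1.
Qed.

(** Rank-nullity for z |-> z A on vectors of degree at most k. *)
Lemma rank_kermx_conv k t : conv_onto e k.+1 A ->
  (\sum_j e j = (m - N) * k + t)%N -> (t <= m - N)%N ->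
  \rank (kermx (conv e k.+1 A)) = (m - N - t)%N.
Proof.
move=> onto dimE tmN; have /conv_ontoP-/(_ Ae)/eqP full := onto.
rewrite mxrank_ker full card_source card_target big_split /= sum_nat_const
  card_ord.
have Nm : (N <= m)%N by rewrite -{1}(rank_frac_onto onto) rank_leq_row.
rewrite dimE; move: tmN; set n := (m - N)%N => tn.
have -> : m = (N + n)%N by rewrite /n subnKC.
rewrite mulnDl; nia.
Qed.

End Kernel.

(** * Zigzag matrices *)

Section Windows.
Variables (T : nzRingType) (p : nat -> nat).

Lemma windows_unique n k (y : nat -> {poly T}) :
  (forall l, p l + k <= p l.+1)%N -> (forall l, (size (y l) <= k)%N) ->
  \sum_(l < n) y l * 'X^(p l) = 0 -> forall l, (l < n)%N -> y l = 0.
Proof.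
move=> gap yk E l ln; have mono a b : (a < b)%N -> (p a + k <= p b)%N.
  elim: b => // b IH; rewrite ltnS leq_eqVlt => /orP[/eqP-> //|/IH h].
  by apply: leq_trans h (leq_trans (leq_addr k _) (gap b)).
apply/polyP => a; rewrite coef0; case: (ltnP a k) => ak; last first.
  by rewrite nth_default // (leq_trans (yk l)).
have /polyP/(_ (p l + a)%N) :=
  E; rewrite coef0 coef_sum (bigD1 (Ordinal ln)) //=.
rewrite coefMXn ltnNge leq_addr /= addnC addnK big1 ?addr0 // => l' ll'.
rewrite coefMXn; case: ltnP => // h; rewrite nth_default //.
apply: leq_trans (yk l') _; case: (ltngtP l' l) => c; last 1 first.
- by case/eqP: ll'; apply: val_inj.
- by have := mono _ _ c; move: h ak; lia.
- by have := mono _ _ c; move: h ak; lia.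
Qed.

Lemma windows_cover n (H : {poly T}) :
  p 0 = 0%N -> (forall l, p l <= p l.+1)%N ->
  H = \sum_(l < n) take_poly (p l.+1 - p l) (drop_poly (p l) H) * 'X^(p l)
      + drop_poly (p n) H * 'X^(p n).
Proof.
move=> p0 mono; elim: n => [|n IH].
  by rewrite big_ord0 add0r p0 drop_poly0l expr0 mulr1.
rewrite big_ord_recr /= {1}IH -addrA; congr (_ + _).
rewrite -{1}(poly_take_drop (p n.+1 - p n) (drop_poly (p n) H)) mulrDl;
  congr (_ + _).
rewrite -mulrA -exprD subnK //; congr (_ * _).
by apply/polyP => i; rewrite !coef_drop_poly -addnA subnK.
Qed.
End Windows.

(** Mark on the segment from 0 to e_0 + ... + e_N the partial sums of e, which
    cut it into one interval for each column, and the points p_0, ..., p_n.  A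
    zigzag matrix has a row for each interior partial sum, with entries in the
    two columns that meet there, and a row for each p_l, with one entry in a
    column whose interval contains p_l; exponents measure distances from the
    left end of the interval.  Multiplication by the column of the powers of X
    at the left ends kills the rows of the first kind and maps that of p_l to
    X^(p_l).  So the map z |-> z A on vectors of degree < k is one-to-one if
    the windows from p_l to p_l + k - 1 are disjoint, and onto if they cover
    all degrees that occur. *)
Section Zigzag.
Variables (F : fieldType) (N n : nat) (e p : nat -> nat).
Variable c : 'I_n.+1 -> 'I_N.+1.

Definition psum i := (\sum_(l < i) e l)%N.

Lemma psumS i : psum i.+1 = (psum i + e i)%N.
Proof. exact: big_ord_recr. Qed.

Hypothesis cP : forall l, (psum (c l) <= p l <= psum (c l).+1)%N.

Definition zigzag_steps : 'M[{poly F}]_(N, N.+1) :=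
  \matrix_(i, j) if (j == i :> nat) then 'X^(e i)
                 else if (j == i.+1 :> nat) then - 1 else 0.

Definition zigzag_marks : 'M[{poly F}]_(n.+1, N.+1) :=
  \matrix_(l, j) if j == c l then 'X^(p l - psum j) else 0.

Definition zigzag := col_mx zigzag_steps zigzag_marks.

Definition positions : 'cV[{poly F}]_N.+1 := \col_j 'X^(psum j).

Lemma mul_zigzag_steps (C : nat -> {poly F}) j :
  ((\row_(i < N) C i) *m zigzag_steps) 0 j =
  (if (j < N)%N then C j * 'X^(e j) else 0) - (if (0 < j)%N then C j.-1 else 0).
Proof.
rewrite mxE.
transitivity (\sum_(i < N) ((if (i == j :> nat) then C i * 'X^(e i) else 0)
             - (if (i.+1 == j :> nat) then C i else 0))).
  apply: eq_bigr => i _; rewrite !mxE [i == j :> nat]eq_sym [i.+1 == j :>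
    nat]eq_sym.
  case: (eqVneq (j : nat) i) => [->|_]; first by rewrite ltn_eqF // subr0.
  by case: eqP => _; ring.
rewrite sumrB; congr (_ - _).
  case: ltnP => h; last first.
    by rewrite big1 // => i _; case: eqP => // E; have := ltn_ord i;
      rewrite E ltnNge h.
  rewrite (bigD1 (Ordinal h)) //= eqxx big1 ?addr0 // => i ij;
    case: eqP => // E.
  by case/eqP: ij; apply: val_inj.
case: (nat_of_ord j) (ltn_ord j) => [|j'] hj /=; first by rewrite big1.
rewrite (bigD1 (Ordinal (hj : j' < N)%N)) //= eqxx big1 ?addr0 // => i ij.
by case: eqP => // -[E]; case/eqP: ij; apply: val_inj.
Qed.

Lemma psum_mono a b : (a <= b)%N -> (psum a <= psum b)%N.
Proof.
elim: b => [|b IH]; first by rewrite leqn0 => /eqP ->.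
rewrite leq_eqVlt => /orP[/eqP -> //|/IH h]; apply: leq_trans h _.
by rewrite psumS leq_addr.
Qed.

Lemma zigzag_steps_positions : zigzag_steps *m positions = 0.
Proof.
apply/row_matrixP => i; rewrite row_mul row0; apply/rowP => o;
  rewrite !ord1 {o} mxE.
have hi : (i < N.+1)%N by rewrite ltnW // ltnS.
rewrite (bigD1 (Ordinal hi)) //= (bigD1 (lift ord0 i)) /=; last first.
  by apply/eqP => /(congr1 val) /=; rewrite /bump; lia.
rewrite big1 => [|j /andP[j1 j2]].
  by rewrite !mxE /= eqxx /bump /= add1n gtn_eqF // eqxx addr0 mulN1r
     -exprD psumS addnC subrr.
rewrite !mxE; case: eqP => [E|_]; first by case/eqP: j1; apply: val_inj.
case: eqP => [E|_]; first by case/eqP: j2; apply: val_inj; rewrite /= E.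
by rewrite mul0r.
Qed.

Lemma mul_zigzag_marks_positions (y : nat -> {poly F}) :
  (((\row_(l < n.+1) y l) *m zigzag_marks) *m positions) 0 0 =
  \sum_(l < n.+1) y l * 'X^(p l).
Proof.
rewrite -mulmxA mxE; apply: eq_bigr => l _; rewrite mxE; congr (_ * _).
rewrite mxE (bigD1 (c l)) //= !mxE eqxx big1 ?addr0 => [|j jc].
  by rewrite -exprD subnK //; have /andP[] := cP l.
by rewrite mxE (negbTE jc) mul0r.
Qed.

Lemma zigzag_col_degrees : col_degrees (fun j : 'I_N.+1 => e j) zigzag.
Proof.
move=> i j; rewrite mxE; case: splitP => k _; rewrite mxE.
  case: eqP => [->|_]; first by rewrite size_polyXn.
  by case: eqP => _; rewrite ?size_polyN ?size_poly1 ?size_poly0.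
case: eqP => [->|_]; last by rewrite size_poly0.
rewrite size_polyXn ltnS leq_subLR; have /andP[_] := cP k.
by rewrite psumS.
Qed.

(** The coefficients of the marks vanish by windows_unique, and those of the
    steps then vanish one after the other, column by column. *)
Lemma zigzag_inj k : (forall l, p l + k <= p l.+1)%N -> conv_inj k zigzag.
Proof.
move=> gap z zk zA.
pose y l := if insub l is Some o then z 0 (rshift N o) else 0.
pose C i := if insub i is Some o then z 0 (lshift n.+1 o) else 0.
have zE : z = row_mx (\row_(i < N) C i) (\row_(l < n.+1) y l).
  apply/rowP => i; rewrite mxE; case: splitP => o io; rewrite mxE /C /y valK;
  by congr (z _ _); apply: val_inj.
have yk l : (size (y l) <= k)%N.
  rewrite /y; case: insubP => [o _ _|_]; last by rewrite size_poly0.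
  exact: rsizeP zk _.
rewrite zE mul_row_col in zA.
have y0 : forall l, (l < n.+1)%N -> y l = 0.
  apply: (windows_unique gap yk).
  rewrite -mul_zigzag_marks_positions.
  have : (\row_(i < N) C i *m zigzag_steps
          + \row_(l < n.+1) y l *m zigzag_marks) *m positions = 0.
    by rewrite zA mul0mx.
  by rewrite mulmxDl -mulmxA zigzag_steps_positions mulmx0 add0r => ->;
    rewrite mxE.
have yr : \row_(l < n.+1) y l = 0 by apply/rowP => l; rewrite !mxE y0.
rewrite yr mul0mx addr0 in zA.
have C0 i : (i < N)%N -> C i = 0.
  elim: i => [|i IH] iN; have hi := leqW iN;
  have /rowP/(_ (Ordinal hi)) := zA; rewrite mul_zigzag_steps mxE /= iN.
    by rewrite subr0 => /eqP; rewrite mulf_eq0 expf_eq0 polyX_eq0 andbF orbF =>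
      /eqP.
  rewrite IH ?subr0; last exact: ltnW.
  by move=> /eqP; rewrite mulf_eq0 expf_eq0 polyX_eq0 andbF orbF => /eqP.
rewrite zE yr; have -> : \row_(i < N) C i = 0 by apply/rowP => i;
  rewrite !mxE C0.
exact: row_mx0.
Qed.

(** The coefficients of the marks are found by cutting h *m positions into
    windows.  What remains is killed by positions, and the coefficient of each
    step is then its partial sum, shifted down to degree 0. *)
Lemma zigzag_onto k : p 0 = 0%N -> (forall l, p l <= p l.+1 <= p l + k)%N ->
  p n = psum N.+1 -> conv_onto (fun j : 'I_N.+1 => e j) k zigzag.
Proof.
move=> p0 gap pn h hk.
have sizeS (g : 'rV[{poly F}]_N.+1) i :
    (forall j : 'I_N.+1, (size (g 0%R j) <= k + e j)%N) -> (i <= N.+1)%N ->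
    (size (\sum_(l < i) g 0 (inord l) * 'X^(psum l))%R <= k + psum i)%N.
  move=> gk iN; apply: size_sum_leq => l.
  apply: leq_trans (size_polyMleq _ _) _; rewrite size_polyXn addnS /=.
  have lN : (l < N.+1)%N by exact: leq_trans (ltn_ord l) iN.
  have := gk (inord l); rewrite inordK // => gl.
  apply: leq_trans (leq_add gl (leqnn _)) _; rewrite -addnA leq_add2l.
  by apply: leq_trans (psum_mono (ltn_ord l)); rewrite psumS addnC.
pose H := (h *m positions) 0 0.
have posE (g : 'rV[{poly F}]_N.+1) :
    (g *m positions) 0 0 = \sum_(l < N.+1) g 0 (inord l) * 'X^(psum l).
  by rewrite mxE; apply: eq_bigr => l _; rewrite mxE inord_val.
have Hk : (size H <= k + psum N.+1)%N by rewrite /H posE; exact: sizeS.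
pose y l := if (l < n)%N then take_poly (p l.+1 - p l) (drop_poly (p l) H)
            else drop_poly (p n) H.
have yk l : (size (y l) <= k)%N.
  rewrite /y; case: ifP => _; last by rewrite size_drop_poly leq_subLR pn addnC.
  apply: leq_trans (size_take_poly _ _) _; rewrite leq_subLR.
  by have /andP[] := gap l.
have Hy : H = \sum_(l < n.+1) y l * 'X^(p l).
  rewrite big_ord_recr /= /y ltnn {1}(@windows_cover _ p n H) //; last first.
    by move=> l; have /andP[] := gap l.
  by congr (_ + _); apply: eq_bigr => l _; rewrite ltn_ord.
pose yr := \row_(l < n.+1) y l.
pose g := h - yr *m zigzag_marks.
have gk (j : 'I_N.+1) : (size (g 0%R j) <= k + e j)%N.
  rewrite !mxE; apply: leq_trans (size_polyD _ _) _;
    rewrite geq_max hk size_polyN.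
  have zk : (rsize (row_mx (0 : 'rV[{poly F}]_N) yr) <= k)%N.
    by apply/rsizeP => i; rewrite mxE; case: splitP => o _;
      rewrite mxE ?size_poly0.
  have := size_mul_col_degrees j zigzag_col_degrees zk.
  by rewrite mul_row_col mul0mx add0r mxE.
have gpos : \sum_(l < N.+1) g 0 (inord l) * 'X^(psum l) = 0.
  rewrite -posE /g mulmxBl mxE [X in _ + X]mxE mul_zigzag_marks_positions -Hy.
  by rewrite subrr.
pose S i := \sum_(l < i) g 0 (inord l) * 'X^(psum l).
pose C i := drop_poly (psum i.+1) (S i.+1).
have SC i : (i < N)%N -> C i * 'X^(psum i.+1) = S i.+1.
  move=> iN; rewrite -[RHS](poly_take_drop (psum i.+1)); rewrite -[LHS]add0r;
    congr (_ + _).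
  apply/polyP => a; rewrite coef0 coef_take_poly; case: ltnP => // ha.
  have : \sum_(0 <= l < N.+1) g 0 (inord l) * 'X^(psum l) = 0.
    by rewrite big_mkord.
  rewrite (@big_cat_nat _ _ _ i.+1) //=; last exact: leqW.
  rewrite big_mkord -/(S i.+1).
  move/eqP; rewrite addr_eq0 => /eqP ->;
    rewrite coefN coef_sum big_nat big1 ?oppr0 //.
  move=> l /andP[il _]; rewrite coefMXn ifT //; apply: leq_trans ha _;
    exact: psum_mono.
exists (row_mx (\row_(i < N) C i) yr).
  apply/rsizeP => i; rewrite mxE; case: splitP => o _; rewrite mxE // /C.
  rewrite size_drop_poly leq_subLR addnC; apply: sizeS => //.
  by rewrite ltnS ltnW.
rewrite mul_row_col.
suff -> : \row_(i < N) C i *m zigzag_steps = g by rewrite subrK.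
apply/rowP => j; apply: (@mulIf _ ('X^(psum j)));
  first by rewrite expf_neq0 // polyX_eq0.
rewrite mul_zigzag_steps mulrBl.
have -> : (if (j < N)%N then C j * 'X^(e j) else 0) * 'X^(psum j) = S j.+1.
  case: ltnP => hj; first by rewrite -mulrA -exprD addnC -SC // psumS.
  have -> : j = N :> nat by have := ltn_ord j; lia.
  by rewrite mul0r [RHS]gpos.
have -> : (if (0 < j)%N then C j.-1 else 0) * 'X^(psum j) = S j.
  case: (nat_of_ord j) (ltn_ord j) => [|i] hi /=; last by rewrite SC.
  by rewrite mul0r [RHS]big_ord0.
by rewrite /S big_ord_recr /= addrAC subrr add0r inord_val.
Qed.

End Zigzag.

(** The marks p_l = l L %/ (m - N) have gaps b and b + 1. *)
Lemma zigzag_realization (F : fieldType) (m N : nat) (e : nat -> nat) :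
  (0 < N < m)%N ->
  let L := (\sum_(j < N) e j)%N in let b := (L %/ (m - N))%N in
  exists A : 'M[{poly F}]_(m, N),
    [/\ col_degrees (fun j : 'I_N => e j) A,
        conv_onto (fun j : 'I_N => e j) b.+1 A & conv_inj b A].
Proof.
case: N => // N /andP[_ Nm] L b.
have [n mE] : exists n, m = (N + n.+2)%N by exists (m - N.+2)%N; lia.
have nE : (m - N.+1 = n.+1)%N by lia.
subst m; rewrite nE in b *.
pose p l := (l * L %/ n.+1)%N.
have pn : p n.+1 = L by rewrite /p mulKn.
have gap1 l : (p l + b <= p l.+1)%N.
  by rewrite /p leq_divRL // mulnDl mulSn addnC leq_add ?leq_trunc_div.
have gap2 l : (p l.+1 <= p l + b.+1)%N.
  rewrite -ltnS /p ltn_divLR //.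
  have h1 := ltn_ceil L (ltn0Sn n); have h2 := ltn_ceil (l * L) (ltn0Sn n).
  by rewrite -/b in h1; rewrite mulSn; move: h1 h2; set a := (_ %/ _)%N; nia.
have mono a b' : (a <= b')%N -> (p a <= p b')%N.
  by move=> ab; rewrite leq_div2r // leq_mul2r ab orbT.
have /fin_all_exists [c cP] : forall l : 'I_n.+2, exists i : 'I_N.+1,
    ((\sum_(q < i) e q <= p l)%N && (p l <= \sum_(q < i.+1) e q)%N).
  move=> l; pose Q i := (p l <= \sum_(q < i.+1) e q)%N.
  have QN : Q N by rewrite /Q -/L -pn; apply: mono; rewrite -ltnS.
  have exQ : exists i, Q i by exists N.
  case: (ex_minnP exQ) => i Qi imin;
    have iN : (i < N.+1)%N by rewrite ltnS imin.
  exists (Ordinal iN); rewrite /= [X in _ && X]Qi andbT.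
  case: i Qi imin {iN} => [|i] _ imin; first by rewrite big_ord0.
  by rewrite leqNgt; apply/negP => h; have := imin i (ltnW h); rewrite ltnn.
exists (zigzag F e p c); split.
- exact: zigzag_col_degrees.
- apply: zigzag_onto => // l.
  by rewrite gap2 andbT (leq_trans _ (gap1 l)) ?leq_addr.
- exact: zigzag_inj.
Qed.

(** * Rank of a polynomial matrix and of its values *)

Section RankEvaluation.
Variable F : fieldType.

Lemma det_frac k (M : 'M[{poly F}]_k) : \det (frac M) = tofrac (\det M).
Proof. exact: det_map_mx. Qed.

Lemma ev_polyC a p q (M : 'M[F]_(p, q)) : ev a (map_mx polyC M) = M.
Proof. by apply/matrixP => i j; rewrite !mxE /horner_eval hornerC. Qed.

(** A determinant det (X P Y), with X and Y constant, that does not vanish at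
    a is not the zero polynomial. *)
Lemma mxrank_ev_le p q (P : 'M[{poly F}]_(p, q)) a :
  (\rank (ev a P) <= \rank (frac P))%N.
Proof.
have [X [Y XY]] := mxrank_inverses (ev a P).
pose M := map_mx polyC X *m P *m map_mx polyC Y.
apply: (@mxrank_det _ _ _ _ _ (frac (map_mx polyC X)) (frac (map_mx polyC Y))).
rewrite -!map_mxM det_frac tofrac_eq0; apply: contra_eqN XY => /eqP M0.
have : \det (ev a M) = 0 by rewrite det_map_mx M0 rmorph0.
rewrite !map_mxM !ev_polyC => d0; apply/eqP => E; move: d0;
  rewrite E det1 => /eqP.
by rewrite oner_eq0.
Qed.

Lemma mxrank_ev_generic p q (P : 'M[{poly F}]_(p, q)) :
  exists2 f : {poly F}, f != 0 &
    forall a, f.[a] != 0 -> (\rank (frac P) <= \rank (ev a P))%N.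
Proof.
have [X [Y XY]] := mxrank_inverses (frac P).
have [x x0 [X' XE]] := clear_denominators X.
have [y y0 [Y' YE]] := clear_denominators Y.
exists (\det (X' *m P *m Y')) => [|a].
  rewrite -tofrac_eq0 -det_frac !map_mxM -XE -YE -!scalemxAl -scalemxAr XY.
  by rewrite scalerA scalemx1 det_scalar expf_neq0 // mulf_neq0 ?tofrac_eq0.
by rewrite -[_.[a]]/(horner_eval a _) -det_map_mx !map_mxM; exact: mxrank_det.
Qed.
End RankEvaluation.

(** * Minimal indices *)

(** The rows to add are the ones of a maximal free family of rows of Y
    modulo X. *)
Lemma row_free_completion (K : fieldType) p q m
    (X : 'M[K]_(p, m)) (Y : 'M[K]_(q, m)) :
  row_free X -> (X <= Y)%MS ->
  exists f : 'I_(\rank Y - p) -> 'I_q, (Y <= col_mx X (rowsub f Y))%MS.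
Proof.
move=> Xf XY; pose Z := Y *m cokermx X.
have rZ : (\rank Y - p = \rank Z)%N.
  rewrite -(mxrank_mul_ker Y (cokermx X)) -/Z.
  have -> : \rank (Y :&: kermx (cokermx X))%MS = p.
    transitivity (\rank X); last exact/eqP.
    apply/eqmx_rank/andP; split.
      by apply/row_subP => i; rewrite submxE -submxE;
        apply: submx_trans (row_sub i _) _;
         rewrite submxE; apply/eqP/sub_kermxP; exact: capmxSr.
    by rewrite sub_capmx XY; apply/sub_kermxP/eqP; rewrite -submxE.
  by rewrite addnK.
rewrite rZ; exists (maxrankfun Z); apply/row_subP => i.
have : (row i Z <= rowsub (maxrankfun Z) Z)%MS by rewrite eq_maxrowsub row_sub.
rewrite /Z row_mul -mul_rowsub_mx => /submxP[w E].
set G := rowsub _ Y in E *.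
have : (row i Y - w *m G <= X)%MS by rewrite submxE mulmxBl E mulmxA subrr.
rewrite -addsmxE => h; rewrite -[row i Y](subrK (w *m G)).
by rewrite addmx_sub_adds // submxMl.
Qed.

Section TwoValues.
Variables (q k t : nat) (b : 'I_q -> nat).
Hypothesis kb : forall i, (k <= b i)%N.
Hypothesis tq : (t <= q)%N.
Hypothesis few : (#|[set i | (b i <= k)%N]| <= q - t)%N.

Lemma many_above : (t <= \sum_i (k < b i))%N.
Proof.
have := cardsC [set i | (b i <= k)%N]; rewrite card_ord => E.
have -> : (\sum_i (k < b i) = #|~: [set i | (b i <= k)%N]|)%N.
  rewrite -sum1_card [RHS]big_mkcond /=; apply: eq_bigr => i _.
  by rewrite !inE -ltnNge; case: ltnP.
by move: few E; lia.
Qed.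

Lemma above_split i : (k + (k < b i) <= b i)%N.
Proof.
have := kb i; rewrite leq_eqVlt.
by move=> /orP[/eqP <-|h]; rewrite ?ltnn ?addn0 ?h ?addn1.
Qed.

Lemma two_values_sum_ge : (q * k + t <= \sum_i b i)%N.
Proof.
apply: (@leq_trans (\sum_i (k + (k < b i)))); last by apply: leq_sum => i _;
  exact: above_split.
by rewrite big_split /= sum_nat_const card_ord leq_add2l many_above.
Qed.

(** The lower bound q k + t on the sum counts one unit for each value above
    k; when it is attained, these values are k + 1 and there are t of them. *)
Lemma two_values : (\sum_i b i <= q * k + t)%N ->
  sort leq [seq b i | i : 'I_q] = nseq (q - t) k ++ nseq t k.+1.
Proof.
move=> le; have sumE : (\sum_i (k + (k < b i)) = q * k + \sum_i (k < b i))%N.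
  by rewrite big_split /= sum_nat_const card_ord.
have tE : (\sum_i (k < b i) = t)%N.
  apply/eqP; rewrite eqn_leq many_above andbT -(leq_add2l (q * k)) -sumE.
  by apply: leq_trans le; apply: leq_sum => i _; exact: above_split.
have bE i : b i = (k + (k < b i))%N.
  apply/eqP; rewrite eq_sym; move: i; apply/forallP.
  have := leqif_sum (fun (i : 'I_q) (_ : true) => leqif_eq (above_split i)).
  case=> le2 <-; rewrite eqn_leq le2 /=.
  by rewrite sumE tE.
set s := [seq b i | i : 'I_q].
have szs : size s = q by rewrite size_map -cardE card_ord.
have cnt : count (predC1 k) s = t.
  rewrite count_map -sum1_count big_enum_cond /= -[RHS]tE [LHS]big_mkcond /=.
  by apply: eq_bigr => i _; rewrite ltn_neqAle kb andbT eq_sym /=; case: eqP.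
apply: (sorted_eq leq_trans anti_leq).
- exact: (sort_sorted leq_total).
- apply/(sortedP 0%N) => i; rewrite size_cat !size_nseq => hi.
  rewrite !nth_cat !nth_nseq size_nseq; do ![case: ifP => //]; lia.
rewrite (perm_trans (y := s)) ?perm_sort //.
rewrite -(perm_filterC (pred1 k) s) perm_sym.
have -> : seq.filter (pred1 k) s = nseq (q - t) k.
  have /all_pred1P -> : all (pred1 k) (seq.filter (pred1 k) s).
    by exact: filter_all.
  by rewrite size_filter; congr nseq; have := count_predC (pred1 k) s;
    rewrite szs cnt; lia.
have -> // : seq.filter (predC (pred1 k)) s = nseq t k.+1.
rewrite -cnt -size_filter; apply/all_pred1P/allP => x; rewrite mem_filter.
case/andP => /= xk /seq.mapP[i _ xE]; move: xk; rewrite xE bE.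
by case: (k < b i)%N; rewrite ?addn0 ?eqxx // addn1.
Qed.
End TwoValues.

Local Open Scope classical_set_scope.

Section MinimalIndices.
Variable R : realType.
Local Notation C := R[i].
Variables (m N : nat) (e : 'I_N -> nat) (A : 'M[{poly C}]_(m, N)).
Variables (k t : nat).
Hypothesis Ae : col_degrees e A.
Hypothesis A_onto : conv_onto e k.+1 A.
Hypothesis A_inj : conv_inj k A.
Hypothesis dimE : (\sum_j e j = (m - N) * k + t)%N.
Hypothesis tmN : (t <= m - N)%N.

Lemma row_degree_leq (v : 'rV[{poly C}]_m) l :
  (row_degree v <= l)%N = (rsize v <= l.+1)%N.
Proof.
apply/bigmax_leqP/rsizeP => [h b|h b _].
  by have := h b isT; case: (size _).
by have := h b; case: (size _).
Qed.

(** In a polynomial basis, no row has degree < k and at most m - N - t rows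
    have degree k, so that the degrees sum up to (m - N) k + t at least.  This
    bound is attained: a basis of the null vectors of degree at most k
    is free over the fraction field, and can be completed by null vectors of
    degree at most k + 1 because these span the whole kernel.  Hence minimal
    bases are those that attain the bound, and their degrees are forced. *)
Lemma minimal_indices_kernel q (V : 'M[{fraction {poly C}}]_(q, m)) :
  (V == kermx (frac A))%MS ->
  minimal_indices V = nseq (m - N - t) k ++ nseq t k.+1.
Proof.
move=> /eqmxP VK.
have rankE := rank_kermx_conv Ae A_onto dimE tmN.
have rV : \rank V = (m - N)%N by rewrite VK mxrank_ker (rank_frac_onto A_onto).
have polyA (B : 'M[{poly C}]_(\rank V, m)) : polynomial_basis B -> B *m A = 0.
  case=> _ /eqmxP BV; apply: frac_eq0; rewrite map_mxM; apply/sub_kermxP.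
  by rewrite -VK -BV.
have low (B : 'M[{poly C}]_(\rank V, m)) (PB : polynomial_basis B) i :
    (k <= row_degree (row i B))%N.
  rewrite leqNgt; apply/negP => lt.
  have BA := polyA B PB; case: PB => Bfree _.
  have Bi0 : row i B = 0.
    apply: A_inj; last by rewrite -row_mul BA row0.
    by case: k lt => // k'; rewrite ltnS row_degree_leq.
  have : (delta_mx 0 i : 'rV_(\rank V)) *m frac B = 0.
    by rewrite -rowE -map_row Bi0 map_mx0.
  move/eqP; rewrite mulmx_free_eq0 // => /eqP/matrixP/(_ 0 i)/eqP.
  by rewrite !mxE !eqxx oner_eq0.
have few (B : 'M[{poly C}]_(\rank V, m)) : polynomial_basis B ->
    (#|[set i | (row_degree (row i B) <= k)%N]%SET| <= \rank V - t)%N.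
  move=> PB.
  have -> : (\rank V - t = \rank (kermx (conv e k.+1 A)))%N.
    by rewrite rV -rankE.
  have [Bfree _] := PB.
  apply: leq_trans (card_low_rows e k.+1 Bfree (polyA _ PB)).
  by apply: subset_leq_card; apply/fintype.subsetP => i;
    rewrite !inE row_degree_leq.
have tV : (t <= \rank V)%N by rewrite rV.
have [B0 [PB0 B0sum]] : exists B : 'M[{poly C}]_(\rank V, m), polynomial_basis B
  /\
    (\sum_i row_degree (row i B) <= \rank V * k + t)%N.
  have [B1 [B1k B1A B1free _]] := low_kernel_basis Ae k.+1.
  have [B2 [B2k B2A _ B2span]] := low_kernel_basis Ae k.+2.
  have B1f : row_free (frac B1).
    by exact: (low_kernel_free A_inj B1k B1A B1free).
  have B2V : (frac B2 :=: V)%MS.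
    apply/eqmxP/andP; split.
      by rewrite VK; apply/sub_kermxP; rewrite -map_mxM B2A map_mx0.
    apply/row_subP => i.
    have : (row i V <= kermx (frac A))%MS by rewrite -VK row_sub.
    move/sub_kermxP; have [d d0 [z zE]] := clear_denominators (row i V).
    have d1 : tofrac d != 0 by rewrite tofrac_eq0.
    move=> VA; rewrite -(eqmx_scale _ d1) zE.
    apply: (kernel_generated Ae A_onto) => [z' z'k z'A|].
      have [c ->] := B2span z' z'k z'A; rewrite map_mxM; exact: submxMl.
    by apply: frac_eq0; rewrite map_mxM -zE -scalemxAl VA scaler0.
  have B12 : (frac B1 <= frac B2)%MS.
    by rewrite B2V VK; apply/sub_kermxP; rewrite -map_mxM B1A map_mx0.
  have [f fP] := row_free_completion B1f B12.
  set B := col_mx B1 (rowsub f B2).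
  have fB : frac B = col_mx (frac B1) (rowsub f (frac B2)).
    by rewrite map_col_mx; congr col_mx; apply/matrixP => i j; rewrite !mxE.
  have BV : (frac B == V)%MS.
    apply/andP; split.
      rewrite fB -B2V; apply/row_subP => o; rewrite -[o]splitK;
        case: (split o) => j.
        by rewrite /= rowKu (submx_trans (row_sub _ _)).
      by rewrite /= rowKd row_rowsub row_sub.
    by rewrite fB -B2V.
  have Bsum : (\sum_i row_degree (row i B) <= \rank V * k + t)%N.
    rewrite big_split_ord /=.
    apply: (@leq_trans ((m - N - t) * k + t * k.+1)%N); last by rewrite rV;
      move: tmN; nia.
    apply: leq_add.
      rewrite -rankE -[X in (X * k)%N]card_ord -sum_nat_const.
      by apply: leq_sum => i _; rewrite row_degree_leq rowKu.
    have {1}-> : t = (\rank (frac B2) - \rank (kermx (conv e k.+1 A)))%N.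
      by rewrite B2V rV rankE; move: tmN; lia.
    rewrite -[X in (X * k.+1)%N]card_ord -sum_nat_const.
    by apply: leq_sum => i _; rewrite row_degree_leq rowKd row_rowsub.
  (* The number of rows of B is \rank V, but only propositionally. *)
  have : (\rank (kermx (conv e k.+1 A))
          + (\rank (frac B2) - \rank (kermx (conv e k.+1 A))) = \rank V)%N.
    by rewrite B2V rV rankE; move: tmN; lia.
  move: B {fB} BV Bsum; move: (_ + _)%N => q' B BV Bsum q'E; subst q'.
  by exists B; split=> //; split=> //;
    rewrite /row_free -/(fracmx B) (eqmxP BV).
have B0min : minimal_basis B0.
  split=> // B PB; apply: leq_trans B0sum _.
  exact: (two_values_sum_ge (low B PB) tV (few B PB)).
have all_eq s : (exists2 B : 'M[{poly C}]_(\rank V, m), minimal_basis B &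
    s = sort leq [seq row_degree (row i B) | i : 'I__]) ->
    s = nseq (m - N - t) k ++ nseq t k.+1.
  case=> B [PB Bmin] ->.
  rewrite (two_values (low B PB) tV (few B PB)) ?rV //.
  by apply: leq_trans (Bmin _ PB0) B0sum.
apply: all_eq; rewrite /minimal_indices.
set X := [set s | _]; have exX : exists s, X s by eexists; exists B0.
exact: (xgetPex [::] exX).
Qed.

End MinimalIndices.

(** * Absence of elementary divisors *)

Section ElementaryDivisors.
Variable R : realType.
Local Notation C := R[i].
Variable m : nat.
Implicit Types (P : 'M[{poly C}]_m) (g : seq {poly C}).

Lemma mxrank_rows (K : fieldType) p q (B : 'M[K]_(p, q)) (S : {set 'I_p}) :
  (forall i, i \notin S -> row i B = 0) -> (\rank B <= #|S|)%N.
Proof.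
move=> BS; pose BofS := \matrix_(i < #|S|) row (enum_val i) B.
apply: leq_trans (rank_leq_row BofS).
apply: mxrankS; apply/row_subP => i; have [iS|/BS ->] := boolP (i \in S);
  last exact: sub0mx.
have -> : row i B = row (enum_rank_in iS i) BofS.
  by rewrite rowK enum_rankK_in.
exact: row_sub.
Qed.

Lemma row_skew_blocks0 g (a : C) (i : 'I_m) : (g`_(i./2)).[a] = 0 ->
  row i (ev a (skew_blocks m g)) = 0.
Proof.
move=> gi; apply/rowP => j; rewrite !mxE /horner_eval.
case: ifP => [_|_]; first exact: gi.
case: ifP => [/andP[oj /eqP ij]|_]; last by rewrite horner0.
have <- : (i./2 = j./2)%N by rewrite ij /= uphalf_half (negbTE oj).
by rewrite hornerN gi oppr0.
Qed.

(** If an invariant polynomial vanished at a, then two of the 2 (size g)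
    possibly nonzero rows of the Smith form would vanish at a, and the rank of
    P at a would be too small. *)
Lemma skew_smith_form_nonzero P g (a : C) :
  (polrank P <= \rank (ev a P))%N -> skew_smith_form P g ->
  forall p, p \in g -> p.[a] != 0.
Proof.
move=> Pa [rP _ _ [Fm uF FE]] p /(nthP 0)[j jg <-]; apply/eqP => gj0.
have Fa : ev a Fm \in unitmx.
  rewrite unitmxE unitfE det_map_mx /= /horner_eval.
  by move: uF; rewrite /unimodular => /size_poly1P[c c0 ->]; rewrite hornerC.
have rB : \rank (ev a P) = \rank (ev a (skew_blocks m g)).
  rewrite -FE !map_mxM mxrankMfree ?row_free_unit //.
  rewrite -[RHS]mxrank_tr trmx_mul mxrankMfree ?mxrank_tr //.
  by rewrite row_free_unit -map_trmx trmxK.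
pose S := [set i : 'I_m | (g`_(i./2)).[a] != 0]%SET.
have : (\rank (ev a (skew_blocks m g)) <= #|S|)%N.
  apply: mxrank_rows => i; rewrite inE negbK => /eqP; exact: row_skew_blocks0.
rewrite -rB; apply/negP; rewrite -ltnNge; apply: leq_trans Pa.
rewrite rP cardE -(size_map (@nat_of_ord m)) -[(size g).*2](size_iota 0).
rewrite (@leq_ltn_trans (size (rem j.*2 (iota 0 (size g).*2)))) //.
  apply: uniq_leq_size.
    by rewrite map_inj_uniq ?enum_uniq //; exact: ord_inj.
  move=> x /seq.mapP[o]; rewrite mem_enum inE => go ->.
  rewrite mem_rem_uniq ?iota_uniq // inE mem_iota /= add0n; apply/andP; split.
    by apply: contraNneq go => ->; rewrite doubleK gj0.
  rewrite ltnNge; apply: contraNN go => h; rewrite nth_default ?horner0 //.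
  by rewrite -(doubleK (size g)) half_leq.
by rewrite size_rem ?size_iota ?mem_iota /= ?add0n ?ltn_double //; move: jg;
  case: (size g).
Qed.

Lemma full_rank_no_divisors P (a : C) : (polrank P <= \rank (ev a P))%N ->
  elementary_divisors P a = [::] /\ eigenvalue_of P a = false.
Proof.
move=> Pa; have H : all (fun s => s == 0)%N (partial_mults P a).
  rewrite /partial_mults /invariant_polys; case: xgetP => [g _ gP|_] //=.
  apply/allP => s /flattenP[_ /seq.mapP[p pg ->]].
  rewrite !inE orbb => /eqP ->.
  by rewrite mupNroot // rootE; exact: (skew_smith_form_nonzero Pa gP pg).
split.
  rewrite /elementary_divisors.
  elim: (partial_mults P a) H => //= s l IH /andP[/eqP -> /IH].
  by [].
by rewrite /eigenvalue_of; apply/negbTE; rewrite -all_predC;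
  apply: sub_all H => s /eqP ->.
Qed.

End ElementaryDivisors.

(** * Pullbacks of the symplectic form *)

Section SymplecticForm.
Variables (T : comNzRingType) (m r : nat).

Definition symplectic : 'M[T]_(r + r) := block_mx 0 1%:M (- 1%:M) 0.

Definition pullback (A : 'M[T]_(m, r + r)) : 'M[T]_m := A *m symplectic *m A^T.

Lemma pullbackE A a b : pullback A a b =
  \sum_(j < r) (A a (lshift r j) * A b (rshift r j)
                - A a (rshift r j) * A b (lshift r j)).
Proof.
rewrite /pullback -[in LHS](hsubmxK A) mul_row_block tr_row_mx !mulmx0 add0r
  addr0.
rewrite mulmx1 mulmxN mulmx1 mul_row_col mulNmx addrC !mxE -sumrB.
by apply: eq_bigr => j _; rewrite !mxE.
Qed.

Lemma symplectic_sqr : symplectic *m symplectic = - 1%:M.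
Proof.
rewrite mulmx_block !mul0mx !mulmx0 !addr0 !add0r mul1mx mulmx1.
by rewrite -(raddfN (@scalar_mx _ _)) -scalar_mx_block raddfN.
Qed.

Lemma pullback_wedge (u v : 'I_r -> 'rV[T]_m) :
  pullback (row_mx (\matrix_(i, j) u j 0 i) (\matrix_(i, j) v j 0 i)) =
  \sum_j wedge (u j) (v j).
Proof.
apply/matrixP => a b; rewrite pullbackE summxE; apply: eq_bigr => j _.
by rewrite !row_mxEl !row_mxEr wedgeE !mxE.
Qed.

Lemma trmx_symplectic : symplectic^T = - symplectic.
Proof.
by rewrite tr_block_mx opp_block_mx !trmx0 !oppr0 opprK linearN /= trmx1.
Qed.

Lemma trmx_pullback A : (pullback A)^T = - pullback A.
Proof. by rewrite !trmx_mul trmxK trmx_symplectic mulNmx mulmxN mulmxA. Qed.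

Lemma pullback_line A B (s : T) : pullback (A + s *: B) =
  pullback A + s *: (B *m symplectic *m A^T + A *m symplectic *m B^T)
  + (s * s) *: pullback B.
Proof.
rewrite /pullback linearD linearZ /= !mulmxDl !mulmxDr -!scalemxAl -!scalemxAr.
by rewrite scalerA scalerDr !addrA; congr (_ + _); rewrite -!addrA;
  congr (_ + _); rewrite addrC.
Qed.
End SymplecticForm.

Lemma map_pullback (T U : comNzRingType) (f : {rmorphism T -> U}) m r
    (A : 'M_(m, r + r)) :
  map_mx f (pullback A) = pullback (map_mx f A).
Proof.
rewrite /pullback !map_mxM map_trmx /symplectic map_block_mx !map_mx0.
by rewrite raddfN /= map_mx1.
Qed.

Section PullbackRank.
Variables (F : fieldType) (m r : nat).

Lemma rank_pullback_le (A : 'M[F]_(m, r + r)) : (\rank (pullback A) <= r + r)%N.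
Proof.
rewrite /pullback -mulmxA; apply: leq_trans (mxrankM_maxl _ _) _.
exact: rank_leq_col.
Qed.

Lemma symplectic_free : row_free (symplectic F r).
Proof.
apply/row_freeP; exists (- symplectic F r).
by rewrite mulmxN symplectic_sqr opprK.
Qed.

Lemma rank_pullback (A : 'M[F]_(m, r + r)) X : X *m A = 1%:M ->
  \rank (pullback A) = (r + r)%N.
Proof.
move=> XA; apply/eqP; rewrite eqn_leq rank_pullback_le /=.
rewrite -[X in (X <= _)%N](eqP symplectic_free).
have -> : symplectic F r = X *m pullback A *m X^T.
  by rewrite /pullback !mulmxA XA mul1mx -!mulmxA -trmx_mul XA trmx1 mulmx1.
by apply: leq_trans (mxrankM_maxl _ _) _; exact: mxrankM_maxr.
Qed.

Lemma kermxN p q (B : 'M[F]_(p, q)) : (kermx (- B) :=: kermx B)%MS.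
Proof.
apply/eqmxP/andP; split; apply/rV_subP => u /sub_kermxP E; apply/sub_kermxP.
  by apply/eqP; rewrite -oppr_eq0 -mulmxN E.
by rewrite mulmxN E oppr0.
Qed.

Lemma kermx_pullback (A : 'M[F]_(m, r + r)) X : X *m A = 1%:M ->
  (kermx (pullback A) == kermx A)%MS.
Proof.
move=> XA; apply/andP; split; apply/rV_subP => u /sub_kermxP uA;
  apply/sub_kermxP.
  have : u *m (A *m symplectic F r) = 0.
    have -> : A *m symplectic F r = pullback A *m X^T.
      by rewrite /pullback -mulmxA -trmx_mul XA trmx1 mulmx1.
    by rewrite mulmxA uA mul0mx.
  move/eqP; rewrite mulmxA mulmx_free_eq0 ?symplectic_free // => /eqP //.
by rewrite /pullback !mulmxA uA !mul0mx.
Qed.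
End PullbackRank.

Section Leading.
Variables (F : fieldType) (m N : nat) (e : 'I_N -> nat).
Variable A : 'M[{poly F}]_(m, N).
Hypothesis Ae : col_degrees e A.

(** The value of A at infinity, relative to the column degree bounds e. *)
Definition leading_mx : 'M[F]_(m, N) := \matrix_(i, j) (A i j)`_(e j).

(** If z A has the single entry X^(k + e_j), in column j, then the coefficient
    vector of degree k of z is a row of a left inverse. *)
Lemma leading_mx_left_inverse k : conv_onto e k.+1 A ->
  exists X, X *m leading_mx = 1%:M.
Proof.
move=> onto; have /boolp.choice[x xP] : forall j, exists z : 'rV[{poly F}]_m,
    (rsize z <= k.+1)%N /\ z *m A = \row_j' if j' == j then 'X^(k + e j) else 0.
  move=> j; have [|z zk zA] :=
    onto (\row_j' if j' == j then 'X^(k + e j) else 0).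
    move=> j'; rewrite mxE; case: eqP => [->|_]; last by rewrite size_poly0.
    by rewrite size_polyXn addSn.
  by exists z.
exists (\matrix_(j, i) (x j 0 i)`_k); apply/matrixP => j j'.
have [xk /rowP/(_ j')/polyP/(_ (k + e j')%N)] := xP j;
  rewrite !mxE coef_sum => E.
transitivity (\sum_i (x j 0 i * A i j')`_(k + e j')).
  apply: eq_bigr => i _; rewrite !mxE.
  have := coefM_top (rsizeP _ _ xk i) (Ae i j') isT isT.
  by rewrite addSn addnS !subSS subn0.
rewrite E [j' == j]eq_sym; case: eqP => [->|_]; last by rewrite coef0.
by rewrite coefXn eqxx.
Qed.
End Leading.

Section Balanced.
Variables (F : fieldType) (m r d : nat).

(** The columns j < r are the vectors u_j of the wedges, the others the v_j. *)
Definition half_degrees (j : nat) : nat :=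
  if (j < r)%N then d./2 else (d - d./2)%N.

Lemma half_leq : (d./2 <= d)%N.
Proof. by rewrite -{2}(odd_double_half d) -addnn addnA leq_addl. Qed.

Lemma sum_half_degrees : (\sum_(j < r + r) half_degrees j = r * d)%N.
Proof.
rewrite big_split_ord /= (eq_bigr (fun=> d./2)); last first.
  by move=> j _; rewrite /half_degrees ltn_ord.
rewrite [X in (_ + X)%N](eq_bigr (fun=> (d - d./2)%N)); last first.
  by move=> j _; rewrite /half_degrees ltnNge leq_addr.
by rewrite !sum_nat_const card_ord -mulnDr subnKC // half_leq.
Qed.

Local Notation e := (fun j : 'I_(r + r) => half_degrees j).

Variable A : 'M[{poly F}]_(m, r + r).
Hypothesis Ae : col_degrees e A.

Lemma half_degrees_l (j : 'I_r) : half_degrees (lshift r j) = d./2.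
Proof. by rewrite /half_degrees /= ltn_ord. Qed.

Lemma half_degrees_r (j : 'I_r) : half_degrees (rshift r j) = (d - d./2)%N.
Proof. by rewrite /half_degrees /= ltnNge leq_addr. Qed.

Lemma size_pullback a b : (size (pullback A a b) <= d.+1)%N.
Proof.
rewrite pullbackE; apply: size_sum_leq => j.
have h1 i := Ae i (lshift r j); have h2 i := Ae i (rshift r j).
rewrite half_degrees_l in h1; rewrite half_degrees_r in h2.
apply: leq_trans (size_polyD _ _) _; rewrite size_polyN geq_max.
apply/andP; split; apply: leq_trans (size_polyMleq _ _) _.
  rewrite -subn1 leq_subLR; apply: leq_trans (leq_add (h1 a) (h2 b)) _.
  by have := half_leq; lia.
rewrite -subn1 leq_subLR; apply: leq_trans (leq_add (h2 a) (h1 b)) _.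
by have := half_leq; lia.
Qed.

Lemma coef_pullback a b : (pullback A a b)`_d = pullback (leading_mx e A) a b.
Proof.
rewrite !pullbackE coef_sum; apply: eq_bigr => j _.
have h1 i := Ae i (lshift r j); have h2 i := Ae i (rshift r j).
rewrite half_degrees_l in h1; rewrite half_degrees_r in h2.
rewrite coefB !mxE half_degrees_l half_degrees_r; congr (_ - _).
  rewrite -(coefM_top (h1 a) (h2 b)) //; congr (_`_ _).
  by have := half_leq; lia.
rewrite -(coefM_top (h2 a) (h1 b)) //; congr (_`_ _).
by have := half_leq; lia.
Qed.

End Balanced.

(** * The generic complete eigenstructure *)

Section NonRoot.
Variable R : realType.
Local Notation C := R[i].

Lemma small_nonroot (f : {poly C}) (eps : R) : f != 0 -> 0 < eps ->
  exists s : R, [/\ 0 < s, s < eps & f.[s%:C%C] != 0].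
Proof.
move=> f0 eps0; apply: contrapT => H.
pose h n : R := eps / n.+2%:R.
have h0 n : 0 < h n by rewrite divr_gt0.
have hle n : h n < eps by rewrite ltr_pdivrMr // ltr_pMr // ltr1n.
have hinj : injective h.
  move=> a b /(mulfI (lt0r_neq0 eps0))/invr_inj/eqP.
  by rewrite eqr_nat => /eqP [].
pose rs := [seq (h n)%:C%C | n <- iota 0 (size f)].
have : (size rs < size f)%N.
  apply: max_poly_roots f0 _ _.
    apply/allP => x /seq.mapP[n _ ->]; apply/eqP; apply: contrapT => /eqP fn.
    by apply: H; exists (h n); rewrite h0 hle.
  rewrite map_inj_uniq ?iota_uniq // => a b [E]; exact: hinj.
by rewrite size_map size_iota ltnn.
Qed.

End NonRoot.

Section GradedPolynomials.
Variables (R : realType) (m d : nat).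

Lemma POLss_size (P : POLss R m d) a b : (size (P a b) <= d.+1)%N.
Proof. by case: P => Q /= /andP[_ /forallP/(_ a)/forallP/(_ b)]. Qed.

Lemma POLss_skew (P : POLss R m d) : (polmx P)^T = - polmx P.
Proof. by case: P => Q /= /andP[/eqP]. Qed.

End GradedPolynomials.

Section GenericEigenstructure.
Variable R : realType.
Local Notation C := R[i].
Variables (m r d k t : nat).
Hypothesis r0 : (0 < r)%N.
Local Notation e := (fun j : 'I_(r + r) => half_degrees r d j).
Hypothesis dimE : (r * d = (m - (r + r)) * k + t)%N.
Hypothesis tn : (t <= m - (r + r))%N.

Lemma ev0_rev_pol (P : 'M[{poly C}]_m) : ev 0 (rev_pol d P) = coefmx d P.
Proof.
by apply/matrixP => a b; rewrite !mxE /horner_eval horner_coef0 coef_poly subn0.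
Qed.

Lemma ev_rev_pol (P : POLss R m d) a : a != 0 ->
  ev a (rev_pol d P) = a ^+ d *: ev a^-1 P.
Proof.
move=> a0; apply/matrixP => i j; rewrite !mxE /horner_eval.
have Pd := POLss_size P i j.
rewrite (horner_coef_wide _ (size_poly _ _)) (horner_coef_wide _ Pd) mulr_sumr.
rewrite (reindex_inj rev_ord_inj) /=; apply: eq_bigr => l _.
rewrite coef_poly subSS ltnS leq_subr mulrCA; congr (_ * _).
  by congr (_`_ _); have := ltn_ord l; lia.
by rewrite exprVn exprB ?unitfE // -ltnS.
Qed.

(** At a nonzero point a, the reversal of P is a^d P(1/a); a generic point is
    nonzero. *)
Lemma polrank_rev_pol_le (P : POLss R m d) :
  (polrank (rev_pol d P) <= polrank P)%N.
Proof.
have [f f0 fP] := mxrank_ev_generic (rev_pol d P).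
have [s [s0 _ fs]] := small_nonroot f0 ltr01.
apply: leq_trans (fP _ fs) _; have sC : s%:C%C != 0 :> C.
  by apply/eqP => -[E]; move: s0; rewrite E ltxx.
rewrite ev_rev_pol //; apply: leq_trans (mxrank_ev_le P (s%:C%C)^-1).
by rewrite eqmx_scale ?expf_neq0.
Qed.

Variable A : 'M[{poly C}]_(m, r + r).
Hypothesis Ae : col_degrees e A.
Hypothesis A_onto : conv_onto e k.+1 A.
Hypothesis A_inj : conv_inj k A.

(** A left inverse of A, or of its leading matrix, carries the full rank of
    the symplectic matrix over to each value of P, or to its leading
    coefficient, which is the value at 0 of the reversal. *)
Lemma generic_eigenstructure (P : POLss R m d) : polmx P = pullback A ->
  let ind := nseq (m - (r + r) - t) k ++ nseq t k.+1 in
  [/\ polrank P = (r + r)%N, has_degree P d,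
      (forall a, elementary_divisors P a = [::] /\ eigenvalue_of P a = false),
      elementary_divisors_infty P = [::] /\ eigenvalue_infty P = false &
      left_minimal_indices P = ind /\ right_minimal_indices P = ind].
Proof.
move=> PE ind; have [X XA] := conv_onto_left_inverse A_onto.
have XAf : frac X *m frac A = 1%:M by rewrite -map_mxM XA map_mx1.
have rP : polrank P = (r + r)%N.
  by rewrite /polrank /fracmx PE map_pullback; exact: (rank_pullback XAf).
have rPa a : \rank (ev a P) = (r + r)%N.
  rewrite PE map_pullback; apply: (@rank_pullback _ _ _ _ (ev a X)).
  by rewrite -map_mxM XA map_mx1.
have [X1 X1A] := leading_mx_left_inverse Ae A_onto.
have cP : coefmx d P = pullback (leading_mx e A).
  by apply/matrixP => a b; rewrite mxE PE coef_pullback.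
have rcP : \rank (coefmx d P) = (r + r)%N.
  by rewrite cP; exact: (rank_pullback X1A).
have left : left_minimal_indices P = ind.
  rewrite /left_minimal_indices /fracmx PE map_pullback.
  apply: (minimal_indices_kernel Ae A_onto A_inj _ tn (kermx_pullback XAf)).
  by rewrite sum_half_degrees.
split.
- exact: rP.
- split; first by rewrite -mxrank_eq0 rcP addnn double_eq0 -lt0n.
  move=> l dl; apply/matrixP => a b; rewrite !mxE PE; apply: nth_default.
  exact: leq_trans (size_pullback Ae a b) dl.
- by move=> a; apply: full_rank_no_divisors; rewrite rP rPa.
- apply: full_rank_no_divisors; rewrite ev0_rev_pol rcP -rP.
  exact: polrank_rev_pol_le.
- split; first exact: left.
  rewrite /right_minimal_indices /fracmx PE map_pullback trmx_pullback.
  apply: (minimal_indices_kernel Ae A_onto A_inj _ tn).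
    by rewrite sum_half_degrees.
  apply/eqmxP; apply: (eqmx_trans (kermxN (pullback (frac A)))).
  exact/eqmxP/(kermx_pullback XAf).
Qed.

End GenericEigenstructure.

(** * Approximation by balanced wedges *)

Section Modulus.
Variable R : realType.
Local Notation C := R[i].
Implicit Types x y : C.

Lemma nc_ge0 x : 0 <= nc x.
Proof. by case: x => a b; exact: sqrtr_ge0. Qed.

Lemma ncD x y : nc (x + y) <= nc x + nc y.
Proof. exact: le_normcD. Qed.

Lemma ncN x : nc (- x) = nc x.
Proof. exact: normcN. Qed.

Lemma nc_sum (I : finType) (f : I -> C) : nc (\sum_i f i) <= \sum_i nc (f i).
Proof.
elim/big_ind2: _ => [|a b c d h1 h2|//]; first by rewrite Normc.normc0.
exact: le_trans (ncD _ _) (lerD h1 h2).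
Qed.

Lemma nc_real (s : R) : 0 <= s -> nc s%:C%C = s.
Proof. by move=> s0; rewrite /= expr0n /= addr0 sqrtr_sqr ger0_norm. Qed.

Lemma ler_term (I : finType) (f : I -> R) i : (forall j, 0 <= f j) ->
  f i <= \sum_j f j.
Proof. by move=> f0; rewrite (bigD1 i) //= lerDl sumr_ge0. Qed.

(** Otherwise some w <> 0 has w = - w E, which is impossible at an entry of w
    of largest modulus. *)
Lemma det_1D_neq0 k (E : 'M[C]_k) : (forall i j, nc (E i j) * k%:R < 1) ->
  \det (1%:M + E) != 0.
Proof.
move=> Ek; apply/negP => /det0P[w w0 wE].
have [i0 wi0] : exists i, w 0 i != 0.
  apply: contrapT => H; case/eqP: w0; apply/rowP => i; rewrite mxE.
  by apply/eqP; apply: contrapT => /negP h; apply: H; exists i.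
have [i _ imax] := @arg_maxP _ _ 'I_k i0 xpredT (fun j => nc (w 0 j)) isT.
have wi : 0 < nc (w 0 i).
  apply: lt_le_trans (imax i0 isT); rewrite lt_def nc_ge0 andbT.
  by apply: contra_neq wi0; exact: Normc.eq0_normc.
have k0 : (0 < k)%N by case: (k) i0 {wi0} => // -[].
have : w 0 i = - \sum_j w 0 j * E j i.
  have /rowP/(_ i) := wE; rewrite mulmxDr mulmx1 !mxE => /eqP.
  by rewrite addr_eq0 => /eqP.
move/(congr1 nc); rewrite ncN => wE2.
have : nc (w 0 i) < nc (w 0 i); last by rewrite ltxx.
rewrite {1}wE2; apply: le_lt_trans (nc_sum _) _.
apply: (@lt_le_trans _ _ (\sum_(j < k) nc (w 0 i) / k%:R)); last first.
  by rewrite sumr_const card_ord -[_ *+ k]mulr_natr mulfVK // pnatr_eq0 -lt0n.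
apply: ltr_sum => [|j _]; first by apply/hasP; exists i0;
  rewrite ?mem_index_enum.
rewrite Normc.normcM; apply: (@le_lt_trans _ _ (nc (w 0 i) * nc (E j i))).
  by apply: ler_wpM2r; [exact: nc_ge0|exact: imax].
by rewrite ltr_pM2l // -[ltRHS]div1r ltr_pdivlMr ?ltr0n.
Qed.

End Modulus.

Section Closeness.
Variables (R : realType) (m : nat).
Local Notation C := R[i].
Implicit Types P Q S : 'M[{poly C}]_m.

Definition coef_close (eps : R) P Q :=
  forall a b l, nc ((P a b)`_l - (Q a b)`_l) < eps.

Lemma coef_close_trans eps1 eps2 P Q S :
  coef_close eps1 P Q -> coef_close eps2 Q S -> coef_close (eps1 + eps2) P S.
Proof.
move=> PQ QS a b l; have -> : (P a b)`_l - (S a b)`_l =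
  ((P a b)`_l - (Q a b)`_l) + ((Q a b)`_l - (S a b)`_l) by rewrite addrA subrK.
apply: le_lt_trans (ncD _ _) _; apply: ltrD; [exact: PQ|exact: QS].
Qed.

Lemma coef_close_sum (I : finType) (P Q : I -> 'M[{poly C}]_m) eps : 0 < eps ->
  (forall i, coef_close (eps / #|I|.+1%:R) (P i) (Q i)) ->
  coef_close eps (\sum_i P i) (\sum_i Q i).
Proof.
move=> eps0 PQ a b l; rewrite !summxE !coef_sum -sumrB.
apply: le_lt_trans (nc_sum _) _.
apply: (@le_lt_trans _ _ (\sum_(i : I) eps / #|I|.+1%:R)).
  by apply: ler_sum => i _; apply/ltW/PQ.
rewrite sumr_const -[_ *+ #|I|]mulr_natr -mulrA gtr_pMr // mulrC.
by rewrite ltr_pdivrMr ?ltr0n // mul1r ltr_nat.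
Qed.

Definition coef_bound P : R :=
  \sum_a \sum_b \sum_(l < size (P a b)) nc (P a b)`_l.

Lemma coef_bound_ge0 P : 0 <= coef_bound P.
Proof. by do 3![apply: sumr_ge0 => ? _]; exact: nc_ge0. Qed.

Lemma le_coef_bound P a b l : nc (P a b)`_l <= coef_bound P.
Proof.
have [h|h] := ltnP l (size (P a b)); last first.
  by rewrite nth_default // Normc.normc0 coef_bound_ge0.
pose f3 a' b' (l' : 'I_(size (P a' b'))) := nc (P a' b')`_l'.
apply: le_trans (ler_term (Ordinal h) (_ : forall l', 0 <= f3 a b l')) _.
  by move=> l'; exact: nc_ge0.
apply: le_trans (ler_term b (_ : forall b', 0 <= \sum_l' f3 a b' l')) _.
  by move=> b'; apply: sumr_ge0 => ? _; exact: nc_ge0.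
apply: (ler_term a (_ : forall a', 0 <= \sum_b' \sum_l' f3 a' b' l')).
by move=> a'; do 2![apply: sumr_ge0 => ? _]; exact: nc_ge0.
Qed.

Lemma coef_close_line (A B : 'M[{poly C}]_m) eps : 0 < eps ->
  exists2 eta : R, 0 < eta & forall s : R, 0 < s -> s < eta ->
    forall P, coef_close eps P
      (P + (s%:C%C)%:P *: A + ((s%:C%C)%:P * (s%:C%C)%:P) *: B).
Proof.
move=> eps0; pose K := 1 + coef_bound A + coef_bound B.
have A0 := coef_bound_ge0 A; have B0 := coef_bound_ge0 B.
have K0 : 0 < K by rewrite /K; lra.
exists (Num.min 1 (eps / K)); first by rewrite lt_min ltr01 divr_gt0.
move=> s s0; rewrite lt_min ltr_pdivlMr // => /andP[s1 sK] P a b l.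
rewrite !mxE !coefD -polyCM !coefCM.
set x := (A a b)`_l; set y := (B a b)`_l.
have -> : (P a b)`_l - ((P a b)`_l + s%:C%C * x + s%:C%C * s%:C%C * y) =
  - (s%:C%C * x + s%:C%C * s%:C%C * y) by ring.
rewrite ncN; apply: le_lt_trans (ncD _ _) _; rewrite !Normc.normcM.
rewrite nc_real; last exact: ltW.
have xA : nc x <= coef_bound A by exact: le_coef_bound.
have yB : nc y <= coef_bound B by exact: le_coef_bound.
have x0 := nc_ge0 x; have y0 := nc_ge0 y; apply: le_lt_trans sK.
have sy : s * nc y <= nc y by rewrite ler_piMl // ltW.
rewrite -mulrA -mulrDr ler_pM2l // /K -addrA.
have := lerD xA (le_trans sy yB); move: (_ + _) (_ + _) => p q; lra.
Qed.

End Closeness.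

Section BalancedWedge.
Variables (R : realType) (m d : nat).
Local Notation C := R[i].
Implicit Types u v : 'rV[{poly C}]_m.

(** With v = z + X w and s small, this wedge is close to u ^ v.  If z is
    constant and deg u < deg v, then its first vector has degree at most
    deg u + 1 and its second one degree at most deg v - 1. *)
Lemma wedge_shift (c s : C) u w z : s * c = 1 ->
  wedge ('X *: u - s%:P *: z) (w + c%:P *: u) =
  wedge u (z + 'X *: w) - s%:P *: wedge z w.
Proof.
move=> sc; have sc' : s%:P * c%:P = 1 by rewrite -polyCM sc.
apply/matrixP => a b; rewrite !(wedgeE, mxE).
have -> : ('X * u 0 a - s%:P * z 0 a) * (w 0 b + c%:P * u 0 b) -
  (w 0 a + c%:P * u 0 a) * ('X * u 0 b - s%:P * z 0 b) =
  'X * (u 0 a * w 0 b - w 0 a * u 0 b) - s%:P * (z 0 a * w 0 b - w 0 a * z 0 b)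
  - (s%:P * c%:P) * (z 0 a * u 0 b - u 0 a * z 0 b) by ring.
by rewrite sc'; ring.
Qed.

Lemma wedge_balance_step k u v eps : (k < d./2)%N -> 0 < eps ->
  (rsize u <= k.+1)%N -> (rsize v <= (d - k).+1)%N ->
  exists u' v', [/\ (rsize u' <= k.+2)%N, (rsize v' <= (d - k.+1).+1)%N &
    coef_close eps (wedge u v) (wedge u' v')].
Proof.
move=> kd eps0 uk vk.
pose z := map_mx (fun p : {poly C} => (p`_0)%:P) v.
pose w := map_mx (drop_poly 1) v.
have vE : v = z + 'X *: w by exact: constant_shift.
have [eta eta0 etaP] := coef_close_line (- wedge z w) 0 eps0.
pose s := eta / 2%:R; have s0 : 0 < s by rewrite divr_gt0.
have sC : s%:C%C != 0 :> C by apply/eqP => -[E]; move: s0; rewrite E ltxx.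
exists ('X *: u - (s%:C%C)%:P *: z), (w + ((s%:C%C)^-1)%:P *: u); split.
- apply/rsizeP => b; rewrite !mxE; apply: leq_trans (size_polyD _ _) _.
  rewrite size_polyN geq_max; apply/andP; split.
    apply: leq_trans (size_polyMleq _ _) _; rewrite size_polyX /=.
    exact: rsizeP uk b.
  rewrite -polyCM; exact: leq_trans (size_polyC_leq1 _) _.
- apply/rsizeP => b; rewrite !mxE; apply: leq_trans (size_polyD _ _) _.
  rewrite geq_max size_drop_poly mul_polyC; apply/andP; split.
    by rewrite leq_subLR; apply: leq_trans (rsizeP _ _ vk b) _; move: kd; lia.
  apply: leq_trans (size_scale_leq _ _) _; apply: leq_trans (rsizeP _ _ uk b) _.
  by move: kd; lia.
rewrite wedge_shift ?divff // -vE.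
have sEta : s < eta by rewrite /s; lra.
by have := etaP s s0 sEta (wedge u v); rewrite scaler0 addr0 scalerN.
Qed.

(** As wedge v (- u) = wedge u v, the shorter vector may be taken first. *)
Lemma wedge_balance k u v eps : (k <= d)%N -> 0 < eps ->
  (rsize u <= k.+1)%N -> (rsize v <= (d - k).+1)%N ->
  exists u' v', [/\ (rsize u' <= d./2.+1)%N, (rsize v' <= (d - d./2).+1)%N &
    coef_close eps (wedge u v) (wedge u' v')].
Proof.
wlog kd : k u v / (k <= d./2)%N => [WL|].
  have [|kd] := leqP k d./2; first exact: WL.
  move=> kd' eps0 uk vk; rewrite -wedgeN; apply: (WL (d - k)%N) => //.
  - by rewrite leq_subLR; lia.
  - exact: leq_subr.
  - by rewrite rsizeN subKn.
move=> _; have [n nE] : exists n, (n + k = d./2)%N by exists (d./2 - k)%N;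
  rewrite subnK.
elim: n k kd nE u v eps => [|n IH] k kd nE u v eps eps0 uk vk.
  exists u, v; rewrite -nE; split=> // a b l; by rewrite subrr Normc.normc0.
have eps20 : 0 < eps / 2%:R by rewrite divr_gt0.
have kd' : (k < d./2)%N by lia.
have [u1 [v1 [u1k v1k c1]]] := wedge_balance_step kd' eps20 uk vk.
have [|u2 [v2 [u2k v2k c2]]] := IH k.+1 kd' _ u1 v1 _ eps20 u1k v1k;
  first by lia.
exists u2, v2; split=> //.
by have := coef_close_trans c1 c2; rewrite -splitr.
Qed.

End BalancedWedge.

(** * Density of the generic eigenstructure *)

Section Density.
Variables (R : realType) (m r d : nat).
Local Notation C := R[i].
Local Notation e := (fun j : 'I_(r + r) => half_degrees r d j).

(** The degrees of the two vectors of each wedge can be balanced one wedge at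
    a time. *)
Lemma balanced_approx (P : 'M[{poly C}]_m) eps : 0 < eps -> P^T = - P ->
  (forall a b, (size (P a b) <= d.+1)%N) -> (polrank P <= 2 * r)%N ->
  exists2 A : 'M[{poly C}]_(m, r + r), col_degrees e A &
    coef_close eps P (pullback A).
Proof.
move=> eps0 Ps Pd Pr; have [u0 [v0 PE]] := skew_sum_wedge Ps Pr.
have Pd' a b : (size ((\sum_j wedge (u0 j) (v0 j))%R a b) <= d.+1)%N.
  by rewrite -PE.
have [u [v [uvE uvd]]] := wedge_sum_graded Pd'.
have eps1 : 0 < eps / #|'I_r|.+1%:R by rewrite divr_gt0.
have /boolp.choice[uv uvP] : forall j,
    exists uv : 'rV[{poly C}]_m * 'rV[{poly C}]_m,
    [/\ (rsize uv.1 <= d./2.+1)%N, (rsize uv.2 <= (d - d./2).+1)%N &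
        coef_close (eps / #|'I_r|.+1%:R) (wedge (u j) (v j)) (wedge uv.1 uv.2)].
  move=> j; have [k kd [uk vk]] := uvd j.
  have [u' [v' h]] := wedge_balance kd eps1 uk vk; by exists (u', v').
exists (row_mx (\matrix_(i, j) (uv j).1 0 i) (\matrix_(i, j) (uv j).2 0 i)).
  move=> i j; rewrite mxE /half_degrees; case: splitP => k _; rewrite mxE.
    by have [h _ _] := uvP k; exact: rsizeP h i.
  by have [_ h _] := uvP k; exact: rsizeP h i.
have -> := pullback_wedge (fun j => (uv j).1) (fun j => (uv j).2).
have -> : P = \sum_j wedge (u j) (v j) by exact: etrans PE (esym uvE).
apply: coef_close_sum eps0 _ => j.
by have [_ _ h] := uvP j; exact: h.
Qed.

(** After approximation by A J A^T, move A slightly towards A1, avoiding the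
    finitely many points of the line where the rank conditions fail. *)
Lemma generic_approx k (A1 : 'M[{poly C}]_(m, r + r)) (P : 'M[{poly C}]_m) eps :
  col_degrees e A1 -> conv_onto e k.+1 A1 -> conv_inj k A1 ->
  0 < eps -> P^T = - P ->
  (forall a b, (size (P a b) <= d.+1)%N) -> (polrank P <= 2 * r)%N ->
  exists A : 'M[{poly C}]_(m, r + r),
    [/\ col_degrees e A, conv_onto e k.+1 A, conv_inj k A &
        coef_close eps P (pullback A)].
Proof.
move=> A1e A1onto A1inj eps0 Ps Pd Pr.
have eps20 : 0 < eps / 2%:R by rewrite divr_gt0.
have [A Ae PA] := balanced_approx eps20 Ps Pd Pr.
have [f f0 fP] := conv_rank_line e k.+1 A A1.
have [g g0 gP] := conv_rank_line e k A A1.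
pose B := A1 - A.
have [eta eta0 etaP] := coef_close_line
  (B *m symplectic _ r *m A^T + A *m symplectic _ r *m B^T) (pullback B) eps20.
have fg0 : f * g != 0 by rewrite mulf_neq0.
have [s [s0 seta]] := small_nonroot fg0 eta0.
rewrite hornerM mulf_eq0 negb_or => /andP[/fP fs /gP gs].
pose As := A + (s%:C%C)%:P *: B; exists As.
have Ase : col_degrees e As by exact: col_degrees_line.
split=> //.
- apply/(conv_ontoP _ Ase); rewrite /row_full eqn_leq rank_leq_col /=.
  by apply: leq_trans fs; have /conv_ontoP-/(_ A1e)/eqP -> := A1onto.
- apply/(conv_injP _ Ase); rewrite /row_free eqn_leq rank_leq_row /=.
  by apply: leq_trans gs; have /conv_injP-/(_ e A1e)/eqP -> := A1inj.
rewrite [eps]splitr; apply: coef_close_trans PA _.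
rewrite /As pullback_line; exact: etaP.
Qed.

End Density.

(** * Semicontinuity of the rank *)

Section Semicontinuity.
Variables (R : realType).
Local Notation C := R[i].

Definition entry_sum p q (X : 'M[C]_(p, q)) : R := \sum_a \sum_b nc (X a b).

Lemma row_sum_le p q (X : 'M[C]_(p, q)) a : \sum_b nc (X a b) <= entry_sum X.
Proof.
apply: (ler_term a (_ : forall a', 0 <= \sum_b nc (X a' b))) => a'.
by apply: sumr_ge0 => ? _; exact: nc_ge0.
Qed.

Lemma col_sum_le p q (X : 'M[C]_(p, q)) b : \sum_a nc (X a b) <= entry_sum X.
Proof.
apply: ler_sum => a _; apply: (ler_term b (_ : forall b', 0 <= nc (X a b'))) =>
  b'.
exact: nc_ge0.
Qed.

Lemma entry_sum_ge0 p q (X : 'M[C]_(p, q)) : 0 <= entry_sum X.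
Proof. by do 2![apply: sumr_ge0 => ? _]; exact: nc_ge0. Qed.

Lemma nc_mulmx3 p q q' p' (X : 'M[C]_(p, q)) (D : 'M_(q, q'))
    (Y : 'M_(q', p')) eta a b :
  0 <= eta -> (forall i j, nc (D i j) <= eta) ->
  nc ((X *m D *m Y) a b) <= entry_sum X * eta * entry_sum Y.
Proof.
move=> eta0 De; rewrite mxE; apply: le_trans (nc_sum _) _.
have XD c : nc ((X *m D) a c) <= entry_sum X * eta.
  rewrite mxE; apply: le_trans (nc_sum _) _.
  apply: (@le_trans _ _ (\sum_l nc (X a l) * eta)).
    by apply: ler_sum => l _; rewrite Normc.normcM ler_wpM2l ?nc_ge0.
  by rewrite -mulr_suml ler_wpM2r // row_sum_le.
apply: (@le_trans _ _ (\sum_c entry_sum X * eta * nc (Y c b))).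
  by apply: ler_sum => c _; rewrite Normc.normcM ler_wpM2r ?nc_ge0.
by rewrite -mulr_sumr ler_wpM2l ?mulr_ge0 ?entry_sum_ge0 // col_sum_le.
Qed.

(** At a generic point x the matrix P(x) has the rank k of P, so that
    X P(x) Y = 1 for constant matrices X and Y of the appropriate sizes.  For
    Q close to P, X Q(x) Y is a small perturbation of the identity of size k,
    and remains invertible. *)
Lemma rank_lower_semicontinuous m d (P : 'M[{poly C}]_m) :
  (forall a b, (size (P a b) <= d.+1)%N) ->
  exists2 eps : R, 0 < eps & forall Q : 'M[{poly C}]_m,
    (forall a b, (size (Q a b) <= d.+1)%N) -> coef_close eps P Q ->
    (polrank P <= polrank Q)%N.
Proof.
move=> Pd; have [f f0 fP] := mxrank_ev_generic P.
have [s [_ _ /fP sP]] := small_nonroot f0 (ltr01 : 0 < 1 :> R).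
move: sP; set x := s%:C%C => sP.
have [X [Y XY]] := mxrank_inverses (ev x P).
set k := \rank (ev x P) in X Y XY sP.
pose B : R := \sum_(l < d.+1) nc (x ^+ l).
have B0 : 0 <= B by apply: sumr_ge0 => ? _; exact: nc_ge0.
pose M := entry_sum X * B * entry_sum Y.
have M0 : 0 <= M by rewrite !mulr_ge0 ?entry_sum_ge0.
have k0 : 0 <= k%:R :> R by [].
pose K := (1 + M) * (1 + k%:R) : R.
have K0 : 0 < K by rewrite mulr_gt0 // ltr_pwDl.
exists K^-1; rewrite ?invr_gt0 // => Q Qd PQ.
have evE (T : 'M[{poly C}]_m) a b : (size (T a b) <= d.+1)%N ->
    ev x T a b = \sum_(l < d.+1) (T a b)`_l * x ^+ l.
  by move=> h; rewrite mxE /horner_eval (horner_coef_wide _ h).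
have DB a b : nc ((ev x Q - ev x P) a b) <= K^-1 * B.
  have -> : (ev x Q - ev x P) a b = ev x Q a b - ev x P a b.
    by rewrite mxE [X in _ + X]mxE.
  rewrite !evE // -sumrB; apply: le_trans (nc_sum _) _.
  rewrite mulr_sumr; apply: ler_sum => l _.
  rewrite -mulrBl Normc.normcM ler_wpM2r ?nc_ge0 // -ncN opprB.
  by apply: ltW; exact: PQ.
have KB0 : 0 <= K^-1 * B by rewrite mulr_ge0 // invr_ge0 ltW.
have XQY : X *m ev x Q *m Y = 1%:M + X *m (ev x Q - ev x P) *m Y.
  by rewrite mulmxBr mulmxBl XY addrC subrK.
apply: leq_trans sP _; apply: leq_trans (mxrank_ev_le Q x).
apply: (mxrank_det (X := X) (Y := Y)); rewrite XQY; apply: det_1D_neq0 => i j.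
apply: (@le_lt_trans _ _ (entry_sum X * (K^-1 * B) * entry_sum Y * k%:R)).
  by rewrite ler_wpM2r //; exact: nc_mulmx3.
have -> : entry_sum X * (K^-1 * B) * entry_sum Y * k%:R = (M * k%:R) / K.
  by rewrite /M; ring.
rewrite ltr_pdivrMr // mul1r /K; move: M0 k0; move: (M) (k%:R : R) => p q; nra.
Qed.

End Semicontinuity.

(** * The metric topology and the orbit closure *)

Section Topology.
Variables (R : realType) (m d : nat).
Local Notation C := R[i].

Lemma sqrt_sum_sqr_le (I : finType) (f : I -> R) : (forall i, 0 <= f i) ->
  Num.sqrt (\sum_i f i ^+ 2) <= \sum_i f i.
Proof.
move=> f0; have s0 : 0 <= \sum_i f i by exact: sumr_ge0.
rewrite -[leRHS](ger0_norm s0) -sqrtr_sqr; apply: ler_wsqrtr.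
rewrite [leRHS]expr2 mulr_suml; apply: ler_sum => i _.
by rewrite expr2 ler_wpM2l // ler_term.
Qed.

Lemma le_sqrt_sum_sqr (I : finType) (f : I -> R) i : (forall i, 0 <= f i) ->
  f i <= Num.sqrt (\sum_i f i ^+ 2).
Proof.
move=> f0; rewrite -[leLHS](ger0_norm (f0 i)) -sqrtr_sqr; apply: ler_wsqrtr.
by apply: (ler_term i (_ : forall j, 0 <= f j ^+ 2)) => j; exact: sqr_ge0.
Qed.

Lemma coef_close_poldist eps : 0 < eps -> exists2 eta : R, 0 < eta &
  forall P Q : POLss R m d, coef_close eta P Q -> poldist P Q < eps.
Proof.
move=> eps0; pose K := (d.+1 * (m * m))%N.
exists (eps / K.+1%:R) => [|P Q PQ]; first by rewrite divr_gt0.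
set eta := eps / _ in PQ.
have frob k : frobenius (coefmx k P - coefmx k Q) <= eta *+ (m * m).
  rewrite /frobenius pair_bigA /=; apply: le_trans (sqrt_sum_sqr_le _) _.
    by move=> ab; exact: nc_ge0.
  have -> : eta *+ (m * m) = \sum_(ab : 'I_m * 'I_m) eta.
    by rewrite sumr_const card_prod !card_ord.
  apply: ler_sum => ab _; apply: ltW; rewrite mxE [X in _ + X]mxE !mxE;
    exact: PQ.
apply: le_lt_trans (sqrt_sum_sqr_le _) _; first by move=> k;
  exact: frobenius_ge0.
apply: (@le_lt_trans _ _ (\sum_(k < d.+1) eta *+ (m * m))).
  by apply: ler_sum => k _; exact: frob.
rewrite sumr_const card_ord -mulrnA mulnC -/K -[_ *+ K]mulr_natr /eta.
by rewrite -mulrA gtr_pMr // mulrC ltr_pdivrMr ?ltr0n // mul1r ltr_nat.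
Qed.

Lemma poldist_coef_close eps (P Q : POLss R m d) : poldist P Q < eps ->
  coef_close eps P Q.
Proof.
move=> PQ a b l; apply: le_lt_trans PQ; have [ld|ld] := ltnP l d.+1; last first.
  rewrite !nth_default ?(leq_trans (POLss_size _ _ _)) // subrr Normc.normc0.
  exact: sqrtr_ge0.
apply: le_trans (le_sqrt_sum_sqr (Ordinal ld) _); last by move=> k;
  exact: frobenius_ge0.
rewrite /= /frobenius pair_bigA /=.
have := @le_sqrt_sum_sqr _ (fun ab : 'I_m * 'I_m =>
  nc ((coefmx l P - coefmx l Q) ab.1 ab.2)) (a, b) (fun _ => nc_ge0 _).
by rewrite /= mxE [X in nc (_ + X)]mxE !mxE.
Qed.

Lemma closure_POLssP (S : set (POLss R m d)) P :
  closure S P <-> forall eps : R, 0 < eps -> exists Q, S Q /\ poldist P Q < eps.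
Proof.
split=> [SP eps eps0|H B /nbhs_ballP[eps /= eps0 PB]].
  have [|Q [SQ PQ]] := SP (ball P eps); first exact: nbhsx_ballx.
  by exists Q; split=> //; move: PQ; rewrite ballEmdist.
have [Q [SQ PQ]] := H _ eps0; exists Q; split=> //; apply: PB.
by rewrite ballEmdist.
Qed.

Lemma closed_rank_le k : closed [set P : POLss R m d | (polrank P <= k)%N].
Proof.
move=> P /closure_POLssP HP /=.
have [eps eps0 PQ] := rank_lower_semicontinuous (POLss_size P).
have [Q [Qk /poldist_coef_close h]] := HP _ eps0.
exact: leq_trans (PQ _ (POLss_size Q) h) Qk.
Qed.

Lemma skew_of_grade_pullback r (A : 'M[{poly C}]_(m, r + r)) :
  col_degrees (fun j : 'I_(r + r) => half_degrees r d j) A ->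
  skew_of_grade d (pullback A).
Proof.
move=> Ae; rewrite /skew_of_grade trmx_pullback eqxx /=.
by apply/forallP => a; apply/forallP => b; exact: size_pullback.
Qed.

(** A nonempty list is not the default value, so that it comes from a minimal
    basis of the left kernel. *)
Lemma size_left_minimal_indices (P : 'M[{poly C}]_m) :
  left_minimal_indices P != [::] ->
    size (left_minimal_indices P) = (m - polrank P)%N.
Proof.
rewrite /left_minimal_indices /minimal_indices;
  case: xgetP => [s _ [B _ ->] _|_].
  by rewrite size_sort size_map -cardE card_ord mxrank_ker.
by rewrite eqxx.
Qed.

End Topology.

Theorem theorem4p5 (R : realType) (m r d : nat)
    (hm : (2 <= m)%N) (hd : (1 <= d)%N)
    (hr2 : (2 <= 2 * r)%N) (hrm : (2 * r <= m - 1)%N) :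
  let beta := ((r * d) %/ (m - 2 * r))%N in
  let t := ((r * d) %% (m - 2 * r))%N in
  exists W : POLss R m d,
    [/\ has_degree W d,
        polrank W = (2 * r)%N,
        forall a : R[i], elementary_divisors W a = [::] &
        elementary_divisors_infty W = [::]] /\
    left_minimal_indices W = nseq (m - 2 * r - t) beta ++ nseq t beta.+1 /\
    right_minimal_indices W = left_minimal_indices W /\
    closed [set P : POLss R m d | (polrank P <= 2 * r)%N] /\
    [set P : POLss R m d | (polrank P <= 2 * r)%N] = closure (polss_orbit W).
Proof.
move=> beta t.
have rr : (2 * r = r + r)%N by rewrite mul2n addnn.
have r0 : (0 < r)%N by move: hr2; lia.
have Nm : (0 < r + r < m)%N by move: hm hr2 hrm; lia.
have n0 : (0 < m - 2 * r)%N by move: hm hr2 hrm; lia.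
have dimE : (r * d = (m - (r + r)) * beta + t)%N.
  by rewrite -rr [(_ * beta)%N]mulnC; exact: divn_eq.
have tn : (t <= m - (r + r))%N by rewrite -rr ltnW // ltn_pmod.
have [A [Ae A_onto A_inj]] : exists A : 'M[{poly R[i]}]_(m, r + r),
    [/\ col_degrees (fun j : 'I_(r + r) => half_degrees r d j) A,
        conv_onto (fun j : 'I_(r + r) => half_degrees r d j) beta.+1 A &
        conv_inj beta A].
  by have := zigzag_realization R[i] (half_degrees r d) Nm;
    rewrite sum_half_degrees -rr.
pose W := MkPOLss (skew_of_grade_pullback Ae).
have spec := @generic_eigenstructure R m r d beta t r0 dimE tn.
have [rW dW eW iW [lW rmW]] := spec A Ae A_onto A_inj W erefl.
have [iW1 iW2] := iW.
have closedS := @closed_rank_le R m d (2 * r).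
exists W; split; first split.
- exact: dW.
- by rewrite rr; exact: rW.
- by move=> a; have [h _] := eW a; exact: h.
- exact: iW1.
split; first by rewrite rr; exact: lW.
split; first by rewrite lW; exact: rmW.
split; first exact: closedS.
rewrite eqEsubset; split=> [P /= Pr|]; last first.
  (* The orbit has bounded rank: the number of minimal indices is the corank. *)
  apply: subset_trans closedS; apply: closureS => Q [_ [_ [_ [_ [lQ _]]]]] /=.
  have szW : size (left_minimal_indices W) = (m - (r + r))%N.
    apply: etrans (congr1 size lW) _.
    by rewrite size_cat !size_nseq; apply: subnK; exact: tn.
  have szQ : size (left_minimal_indices Q) = (m - (r + r))%N.
    exact: etrans (esym (congr1 size lQ)) szW.
  have Qn : left_minimal_indices Q != [::].
    by apply/eqP => Q0; move: szQ Nm; rewrite Q0 /=; clear; lia.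
  have := etrans (esym (size_left_minimal_indices Qn)) szQ.
  have : (polrank Q <= m)%N by exact: rank_leq_row.
  by rewrite rr; move: (polrank Q) Nm; clear; lia.
apply/closure_POLssP => eps eps0.
have [eta eta0 etaP] := coef_close_poldist m d eps0.
have [B [Be B_onto B_inj PB]] :=
  generic_approx Ae A_onto A_inj eta0 (POLss_skew P) (POLss_size P) Pr.
pose Q := MkPOLss (skew_of_grade_pullback Be).
exists Q; split; last exact: etaP.
have [_ _ eQ [iQ1 iQ2] [lQ rmQ]] := spec B Be B_onto B_inj Q erefl.
split; first by move=> a; have [_ h1] := eW a; have [_ h2] := eQ a;
  exact: etrans h1 (esym h2).
split; first by move=> a; have [h1 _] := eW a; have [h2 _] := eQ a;
  exact: etrans h1 (esym h2).
split; first exact: etrans iW2 (esym iQ2).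
split; first exact: etrans iW1 (esym iQ1).
split; first exact: etrans lW (esym lQ).
exact: etrans rmW (esym rmQ).
Qed.
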